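(* Let $L=L_G$ be the special alternating link associated to a connected plane bipartite graph $G$. Then there is a flat matrix $A$, whose oriented matroid $M[A]$ is both graphic and cographic, such that the Alexander polynomial of $L$ satisfies $\Delta_L(t)\sim f_A(-t)$, where $\sim$ denotes equality up to multiplication by $\pm t^k$ for some integer $k$.
   Context: **Matrices and $f_A$.** Let $A$ be a real $d\times N$ matrix of rank $d$ with columns $a_1,\dots,a_N\in\mathbb{R}^d$. $A$ is flat if there is a linear form $h$ on $\mathbb{R}^d$ with $h(a_i)=1$ for all $i\in[N]$. The bases of $M[A]$ are the $d$-subsets $B\subset[N]$ with $\{a_i\}_{i\in B}$ a linear basis of $\mathbb{R}^d$; circuits are the inclusion-minimal $C\subset[N]$ with $\{a_i\}_{i\in C}$ linearly dependent. For a circuit $C$ there is a linear dependence $\sum_{i\in C}\lambda_i a_i=0$ with all $\lambda_i\ne0$, unique up to a nonzero scalar; setting $\lambda_i=0$ for $i\notin C$ gives $\lambda_C\in\mathbb{R}^N$. Put $C^+=\{i\in C:\lambda_i>0\}$, $C^-=\{i\in C:\lambda_i<0\}$. The oriented matroid $M[A]$ is the matroid together with the signed circuits $(C^+,C^-)$, each determined up to swapping the two parts. A vector $\rho\in\mathbb{R}^N$ is generic if $(\lambda_C,\rho)\neq0$ for every circuit $C$; given a generic $\rho$ choose $\lambda_C$ with $(\lambda_C,\rho)>0$. For a base $B$, an element $j\in[N]\setminus B$ is externally semi-active if $j\in C^+$ for the unique circuit $C\subset B\cup\{j\}$; $\mathrm{ext}_\rho(B)$ is the number of externally semi-active elements.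 For flat $A$, $$f_A(t)=\sum_{B}t^{\mathrm{ext}_\rho(B)}\,\bigl|\det(a_i)_{i\in B}\bigr|,$$ summed over all bases $B$ of $M[A]$; this is known not to depend on the generic $\rho$. **Graphic / cographic.** An oriented matroid is graphic if it is isomorphic to the one given by the columns of the signed incidence matrix of a directed graph $D$ (the column of an edge from $i$ to $j$ is $\mathbf{e}_i-\mathbf{e}_j$). It is cographic if it is the dual of such an oriented matroid: the ground set is $E(D)$, circuits are the minimal edge cuts (bonds), and the two parts of a bond between $V_1$ and $V_2$ are the edges directed from $V_1$ to $V_2$ and the edges directed from $V_2$ to $V_1$. **Special alternating links.** Given a connected plane bipartite graph $G$, its medial graph $M(G)$ has vertices $v_e$ ($e\in E(G)$), placed at midpoints of edges, with an edge joining $v_e$ and $v_{e'}$ for each time $e,e'$ are consecutive in the boundary of a face of $G$. Faces of $M(G)$ correspond to faces and to vertices of $G$. Orient the edges of $M(G)$ so that the faces surrounding vertices of $G$ are consistently oriented and orientations alternate around the other faces. Choosing over/undercrossings at all vertices of $M(G)$ so that every crossing is positive gives an alternating diagram of an oriented link $L_G$, the (positive) special alternating link of $G$. **Alexander polynomial.** Let $D$ be the planar dual $G^*$ oriented so that each edge of $G^*$ crossing an edge of $G$ keeps a fixed color class of $G$ on its right; $D$ is an Eulerian digraph (indegree equals outdegree at each vertex). For a vertex $r$ of $D$, a spanning tree is a $k$-spanning tree rooted at $r$ if reversing exactly $k$ of its edges produces a tree in which every vertex has a directed path to $r$; $c_k(D,r)$ is the number of these and $P_D(t)=\sum_{k\ge0}c_k(D,r)t^k$,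 which is known not to depend on $r$. By a theorem of Murasugi and Stoimenow, taken here as the definition, the Alexander polynomial (well defined up to $\pm t^k$) of $L_G$ is given by $\Delta_{L_G}(-t)\sim P_D(t)$. *)

(* Defs.v *)
(* MathComp, with real coefficients in an arbitrary [R : realType]. *)
From mathcomp Require Import all_boot all_order all_fingroup all_algebra.
From mathcomp Require Import boolp reals.

Set Implicit Arguments.
Unset Strict Implicit.
Unset Printing Implicit Defensive.

Import Order.TTheory GRing.Theory Num.Theory.
Local Open Scope ring_scope.

(** * Oriented matroids *)

(* An oriented matroid on [E] is given by its signed circuits: [M X Y] means
   that (X, Y) is a signed circuit.  The circuits of the underlying matroid
   are the sets [X :|: Y], and both (X, Y) and (Y, X) are listed. *)
Definition omatroid (E : finType) := {set E} -> {set E} -> Prop.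

Definition om_iso (E E' : finType) (M : omatroid E) (M' : omatroid E') : Prop :=
  exists2 f : E -> E', bijective f &
    forall X Y : {set E}, M X Y <-> M' (f @: X) (f @: Y).

Section Matrices.
Variables (R : realType) (d N : nat) (A : 'M[R]_(d, N)).

Definition cols (C : {set 'I_N}) : seq 'cV[R]_d := [seq col i A | i in C].

(* [h *m A] is the row of values of the linear form [h] on the columns. *)
Definition flat : Prop :=
  exists h : 'rV[R]_d, forall i : 'I_N, (h *m A) 0 i = 1.

Definition is_base (B : {set 'I_N}) : bool :=
  (#|B| == d) && basis_of fullv (cols B).

Definition is_circuit (C : {set 'I_N}) : bool :=
  minset (fun C' : {set 'I_N} => ~~ free (cols C')) C.

Definition supp (l : 'cV[R]_N) : {set 'I_N} := [set i | l i 0 != 0].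
Definition pos_part (l : 'cV[R]_N) : {set 'I_N} := [set i | 0 < l i 0].
Definition neg_part (l : 'cV[R]_N) : {set 'I_N} := [set i | l i 0 < 0].

Definition dot (l rho : 'cV[R]_N) : R := \sum_i l i 0 * rho i 0.

(* [l] is one of the vectors lambda_C, for the circuit [C = supp l]. *)
Definition circuit_vec (l : 'cV[R]_N) : Prop :=
  is_circuit (supp l) /\ A *m l = 0.

Definition om_of_matrix : omatroid 'I_N := fun X Y =>
  exists l : 'cV[R]_N, [/\ circuit_vec l, X = pos_part l & Y = neg_part l].

Definition generic (rho : 'cV[R]_N) : Prop :=
  forall l : 'cV[R]_N, circuit_vec l -> dot l rho != 0.

Definition ext_semi_active (rho : 'cV[R]_N) (B : {set 'I_N}) (j : 'I_N) : Prop :=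
  j \notin B /\
  exists l : 'cV[R]_N,
    [/\ circuit_vec l, supp l \subset j |: B, 0 < dot l rho & j \in pos_part l].

Definition ext (rho : 'cV[R]_N) (B : {set 'I_N}) : nat :=
  #|[set j | `[< ext_semi_active rho B j >]]|.

(* The determinant of the columns indexed by [B], in increasing order; it is
   meaningful when [#|B| = d]. *)
Definition det_cols (B : {set 'I_N}) : R :=
  \det (\matrix_(i < d, k < d) (nth 0 (cols B) k) i 0).

Definition ext_poly (rho : 'cV[R]_N) : {poly R} :=
  \sum_(B : {set 'I_N} | is_base B) `|det_cols B| *: 'X^(ext rho B).

(* "F is the polynomial f_A": the common value of [ext_poly rho] over all
   generic vectors [rho]. *)
Definition is_f (F : {poly R}) : Prop :=
  (exists rho, generic rho) /\ (forall rho, generic rho -> F = ext_poly rho).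

End Matrices.

(** * Directed graphs (multiple edges and loops allowed) *)

Record digraph := Digraph {
  dvertex : finType;
  dedge : finType;
  src : dedge -> dvertex;
  tgt : dedge -> dvertex
}.

Section Digraphs.
Variable D : digraph.

Definition incidence_mx (R : realType) : 'M[R]_(#|dvertex D|, #|dedge D|) :=
  \matrix_(i, k) ((enum_val i == src (enum_val k))%:R
                  - (enum_val i == tgt (enum_val k))%:R).

Definition edges_out (S : {set dvertex D}) : {set dedge D} :=
  [set e | (src e \in S) && (tgt e \notin S)].

Definition edge_cut (S : {set dvertex D}) : {set dedge D} :=
  edges_out S :|: edges_out (~: S).

Definition bond (C : {set dedge D}) : bool :=
  minset (fun C' => (C' != set0) && [exists S, C' == edge_cut S]) C.

Definition bond_om : omatroid (dedge D) := fun X Y =>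
  exists S : {set dvertex D},
    [/\ bond (edge_cut S), X = edges_out S & Y = edges_out (~: S)].

Definition adj_in (T : {set dedge D}) (u v : dvertex D) : bool :=
  [exists e in T, ((src e == u) && (tgt e == v))
               || ((src e == v) && (tgt e == u))].

Definition spanning_connected (T : {set dedge D}) : bool :=
  [forall u, forall v, connect (adj_in T) u v].

(* A cycle is an edge together with a path joining its two ends and avoiding
   that edge; in particular a loop is a cycle. *)
Definition acyclic (T : {set dedge D}) : bool :=
  [forall e in T, ~~ connect (adj_in (T :\ e)) (src e) (tgt e)].

Definition spanning_tree (T : {set dedge D}) : bool :=
  spanning_connected T && acyclic T.

(* One directed step along an edge of [T] after reversing the edges in [S]. *)
Definition step_reversing (T S : {set dedge D}) (u v : dvertex D) : bool :=
  [exists e in T, if e \in S then (tgt e == u) && (src e == v)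
                  else (src e == u) && (tgt e == v)].

Definition k_spanning_tree (r : dvertex D) (k : nat) (T : {set dedge D}) : bool :=
  spanning_tree T &&
  [exists S : {set dedge D},
     [&& S \subset T, #|S| == k & [forall v, connect (step_reversing T S) v r]]].

Definition num_k_trees (r : dvertex D) (k : nat) : nat :=
  #|[set T | k_spanning_tree r k T]|.

(* [num_k_trees r k = 0] for [k > #|dedge D|], so the sum over all k is finite. *)
Definition tree_poly (r : dvertex D) : {poly int} :=
  \sum_(k < #|dedge D|.+1) (num_k_trees r k)%:R *: 'X^k.

End Digraphs.

Definition graphic (R : realType) (E : finType) (M : omatroid E) : Prop :=
  exists D : digraph, om_iso M (om_of_matrix (incidence_mx D R)).

Definition cographic (E : finType) (M : omatroid E) : Prop :=
  exists D : digraph, om_iso M (@bond_om D).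

(** * Plane graphs *)

(* A dart (e, b) is the edge [e] with one of its two directions. *)
Definition rev_dart (E : finType) (x : E * bool) : E * bool := (x.1, ~~ x.2).

(* Connected plane graphs as combinatorial maps of genus zero.
   - [tail x] is the vertex where the dart [x] starts, [left_face x] is the
     face on its left.
   - [rot x] is the dart following [x] in the counterclockwise order around
     [tail x]; hence the dart following [x] along the boundary of
     [left_face x] is [rot^-1 (rev_dart x)].
   - Euler's formula says that the surface is a sphere.
   Every face carries a dart, except in the graph with a single vertex and no
   edge, which has one face and no dart. *)
Record plane_graph := PlaneGraph {
  vertex : finType;
  edge : finType;
  face : finType;
  tail : edge * bool -> vertex;
  left_face : edge * bool -> face;
  rot : {perm edge * bool};
  rotP : forall x y, tail x = tail y <-> fconnect rot x y;
  left_faceP : forall x y, left_face x = left_face y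
     <-> fconnect (fun z => (rot^-1)%g (rev_dart z)) x y;
  left_face_onto : (0 < #|edge|)%N -> forall f, exists x, left_face x = f;
  plane_nonempty : (0 < #|vertex|)%N;
  plane_connected : forall u v : vertex,
    connect (fun a b => [exists x, (tail x == a) && (tail (rev_dart x) == b)]) u v;
  euler_formula : (#|vertex| + #|face| = #|edge| + 2)%N
}.

Section PlaneGraphs.
Variable G : plane_graph.

Definition proper_2coloring (c : vertex G -> bool) : Prop :=
  forall x : edge G * bool, c (tail x) != c (tail (rev_dart x)).

Definition bipartite : Prop := exists c, proper_2coloring c.

(* The direction of [e] starting in the color class [c = true]. *)
Definition dart_from (c : vertex G -> bool) (e : edge G) : edge G * bool :=
  (e, c (tail (e, true))).

(* The dual edge crosses [e] from the left to the right of [dart_from c e], so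
   that the endpoint of [e] in the color class [c = true] is on its right. *)
Definition dual_digraph (c : vertex G -> bool) : digraph :=
  @Digraph (face G) (edge G)
    (fun e => left_face (dart_from c e))
    (fun e => left_face (rev_dart (dart_from c e))).

End PlaneGraphs.

(** * Alexander polynomials *)

(* Equality up to multiplication by [+- t^k] with [k] an integer. *)
Definition sim (R : comNzRingType) (p q : {poly R}) : Prop :=
  exists (s : bool) (m n : nat), 'X^m * p = (-1) ^+ s * ('X^n * q).

(* [Delta] represents the Alexander polynomial of the special alternating link
   of [G]: Delta(-t) ~ P_D(t), for some choice of the color class orienting the
   dual graph D and of the root in D. *)
Definition is_alexander (G : plane_graph) (Delta : {poly int}) : Prop :=
  exists c : vertex G -> bool, proper_2coloring c /\
  exists r : dvertex (dual_digraph c),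
    sim (Delta \Po - 'X) (tree_poly r).

(* Main.v *)
Require Import Defs.
From mathcomp Require Import all_boot all_order all_fingroup all_algebra.
From mathcomp Require Import boolp reals.
From mathcomp Require Import ring lra zify.

(** Let [A] be the signed incidence matrix of [G], with edges directed from one
    colour class to the other and with one row deleted.  A difference of
    indicator functions of colour classes gives the linear form showing that
    [A] is flat, [A] is totally unimodular, and by Euler's formula its kernel is
    the space of coboundaries of the dual digraph [D].  So circuits of [A] are
    bonds of [D], and bases of [A] are complements of spanning trees of [D].

    If the boundary of [rho] in [D] is [|V(D)| - 1] at the root [r] and [-1]
    elsewhere, every bond pairs positively when directed away from the side of
    [r]; hence [ext rho B] is the number of edges of the tree [~: B] directed
    away from [r], and [ext_poly rho] is the tree polynomial of [D].

    For a flat matrix [ext_poly] is the same for all generic vectors: moving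
    along a segment, perturbed so as to cross the walls [dot lambda_C rho = 0]
    one at a time, only the bases [U :\ j] with [U] containing [C] and [j] in
    [C] are affected.  They have the same activities outside [U], and their
    determinants are proportional to the coordinates of [lambda_C], which add up
    to zero by flatness; so the terms with [j] active and those with [j]
    inactive have the same weight and may be exchanged. *)

Set Implicit Arguments.
Unset Strict Implicit.
Unset Printing Implicit Defensive.

Import Order.TTheory GRing.Theory Num.Theory.
Local Open Scope ring_scope.

(** * Kernel vectors, bases and circuits *)

Section Kernel.
Variables (R : realType) (d N : nat) (A : 'M[R]_(d, N)).
Implicit Types (B C U : {set 'I_N}) (l rho : 'cV[R]_N) (j k : 'I_N).

Lemma mulmx_sum_col l : A *m l = \sum_i l i 0 *: col i A.
Proof.
apply/colP => i; rewrite mxE summxE; apply: eq_bigr => k _.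
by rewrite !mxE mulrC.
Qed.

Lemma suppP l C : reflect (forall i, i \notin C -> l i 0 = 0) (supp l \subset C).
Proof.
apply: (iffP subsetP) => [sub i niC | sub i].
  by apply/eqP; apply: contraNT niC => li0; apply: sub; rewrite inE.
by rewrite inE; apply: contraNT => /sub ->.
Qed.

Lemma sum_supp (V : lmodType R) (F : 'I_N -> V) l C : supp l \subset C ->
  \sum_i l i 0 *: F i = \sum_(i in C) l i 0 *: F i.
Proof.
move=> /suppP sub; rewrite [RHS]big_mkcond; apply: eq_bigr => i _.
by case: ifPn => // /sub ->; rewrite scale0r.
Qed.

Lemma suppZ a l : a != 0 -> supp (a *: l) = supp l.
Proof. by move=> a0; apply/setP => i; rewrite !inE mxE mulf_eq0 (negPf a0). Qed.

Lemma suppN0 l : l != 0 -> exists i, l i 0 != 0.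
Proof.
move=> l0; apply/existsP; apply: contraNT l0 => /existsPn l0.
by apply/eqP/colP => i; rewrite mxE; apply/eqP/negPn/l0.
Qed.

(** Expresses independence through the kernel of [A] alone; bases and circuits are handled below by
    kernel vectors and their supports. *)
Lemma free_colsP C :
  reflect (forall l, A *m l = 0 -> supp l \subset C -> l = 0) (free (cols A C)).
Proof.
pose X := map_tuple (fun i => col i A) (enum_tuple C).
have nthX (i : 'I_#|C|) : X`_i = col (enum_val i) A.
  by rewrite -(nth_image 0 (fun i => col i A)).
have sumX l : \sum_(i < #|C|) l (enum_val i) 0 *: X`_i
    = \sum_(i in C) l i 0 *: col i A.
  by rewrite [RHS]big_enum_val; apply: eq_bigr => i _; rewrite nthX.
apply: (iffP (@freeP _ _ _ X)) => [frX l Al sub | ker k].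
  apply/colP => i; rewrite mxE; have [iC | /(suppP _ _ sub) //] := boolP (i \in C).
  have := frX (fun i => l (enum_val i) 0); rewrite sumX -sum_supp //.
  rewrite -mulmx_sum_col => /(_ Al (enum_rank_in iC i)).
  by rewrite enum_rankK_in.
move=> Xk0 i.
(* The coefficients [k], indexed by positions in the enumeration of [C], are extended by zero to all
   columns. *)
pose l : 'cV[R]_N := \col_j oapp k 0 [pick i | enum_val i == j].
have lE i' : l (enum_val i') 0 = k i'.
  rewrite mxE; case: pickP => [i'' /eqP/enum_val_inj -> // | /(_ i')].
  by rewrite eqxx.
have sub : supp l \subset C.
  apply/suppP => j jC; rewrite mxE; case: pickP => // i' /eqP ji'.
  by case/negP: jC; rewrite -ji' enum_valP.
rewrite -lE (ker l) ?mxE // mulmx_sum_col (sum_supp _ sub) -sumX -{}[RHS]Xk0.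
by apply: eq_bigr => i' _; rewrite lE.
Qed.

Lemma size_cols C : size (cols A C) = #|C|.
Proof. by rewrite size_map -cardE. Qed.

Lemma is_baseE B : is_base A B = (#|B| == d) && free (cols A B).
Proof.
rewrite /is_base; case: eqP => //= cB.
by rewrite basisEfree subvf dimvf dim_matrix mulr1 size_cols cB leqnn !andbT.
Qed.

Lemma base_card B : is_base A B -> #|B| = d.
Proof. by rewrite is_baseE => /andP[/eqP]. Qed.

Lemma base_ker B l : is_base A B -> A *m l = 0 -> supp l \subset B -> l = 0.
Proof. by rewrite is_baseE => /andP[_ /free_colsP]; apply. Qed.

Lemma base_gen B (v : 'cV[R]_d) : is_base A B ->
  exists2 l, A *m l = v & supp l \subset B.
Proof.
case/andP=> _ bas; pose X := map_tuple (fun i => col i A) (enum_tuple B).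
have := coord_basis (bas : basis_of fullv X) (memvf v).
set k := fun i => coord X i v => vE.
pose l : 'cV[R]_N := \col_j oapp k 0 [pick i | enum_val i == j].
have sub : supp l \subset B.
  apply/suppP => j jC; rewrite mxE; case: pickP => // i' /eqP ji'.
  by case/negP: jC; rewrite -ji' enum_valP.
exists l => //.
rewrite mulmx_sum_col (sum_supp _ sub) big_enum_val vE.
apply: eq_bigr => i _; rewrite -(nth_image 0 (fun i => col i A)); congr (_ *: _).
rewrite mxE; case: pickP => [i'' /eqP/enum_val_inj -> // | /(_ i)].
by rewrite eqxx.
Qed.

(** The vector of the fundamental circuit of [j] over [B]. Scaling its coordinate at [j] to 1 turns
    semi-activity of [j] into positivity of its pairing with [rho]. *)
Definition fundamental B j l :=
  [/\ A *m l = 0, supp l \subset j |: B & l j 0 = 1].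

Lemma ex_fundamental B j : is_base A B -> j \notin B ->
  exists l, fundamental B j l.
Proof.
move=> bB jB; have [l Al sub] := base_gen (col j A) bB.
have lj : l j 0 = 0 by move/suppP: sub => /(_ _ jB).
exists (delta_mx j 0 - l); split.
- by rewrite mulmxBr -colE Al subrr.
- apply/suppP => i; rewrite !inE negb_or => /andP[/negPf ij iB].
  by rewrite !mxE ij (suppP _ _ sub) // subr0.
- by rewrite !mxE lj !eqxx subr0.
Qed.

(** The combination of [l] and [l'] that cancels at [j] is supported in the base, hence zero. *)
Lemma base_ker_line B j l l' : is_base A B ->
  A *m l = 0 -> supp l \subset j |: B -> l j 0 != 0 ->
  A *m l' = 0 -> supp l' \subset j |: B -> l' = (l' j 0 / l j 0) *: l.
Proof.
move=> bB Al sub lj Al' sub'.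
apply/eqP; rewrite -subr_eq0; apply/eqP/(base_ker bB).
  by rewrite mulmxBr -scalemxAr Al Al' scaler0 subr0.
apply/suppP => i iB; rewrite !mxE; have [-> | ij] := eqVneq i j.
  by rewrite divfK ?subrr.
have ijB: i \notin j |: B by rewrite !inE negb_or ij.
by rewrite (suppP _ _ sub i ijB) (suppP _ _ sub' i ijB) mulr0 subrr.
Qed.

Lemma fundamentalP B j l l' : is_base A B -> fundamental B j l ->
  A *m l' = 0 -> supp l' \subset j |: B -> l' = l' j 0 *: l.
Proof.
move=> bB [Al sub lj] Al' sub'.
have := base_ker_line bB Al sub _ Al' sub'.
by rewrite lj divr1; apply; rewrite oner_neq0.
Qed.

Lemma fundamental_neq0 B j l : fundamental B j l -> l != 0.
Proof.
case=> _ _ lj; apply: contra_eq_neq lj => ->; rewrite mxE eq_sym.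
exact: oner_neq0.
Qed.

(** Any nonzero dependence inside [supp l] is a multiple of [l], so it has the same support; this is
    the required minimality. *)
Lemma fundamental_circuit B j l : is_base A B -> fundamental B j l ->
  circuit_vec A l.
Proof.
move=> bB fl; have [Al sub lj] := fl; split=> //.
apply/minsetP; split=> [|C /free_colsP nfr sC].
  apply/negP => /free_colsP /(_ _ Al (subxx _)) /eqP.
  by rewrite (negPf (fundamental_neq0 fl)).
move: nfr => /existsNP[l' /not_implyP[Al' /not_implyP[sub' /eqP l'0]]].
have l'E := fundamentalP bB fl Al' (subset_trans sub' (subset_trans sC sub)).
apply/eqP; rewrite eqEsubset sC -(@suppZ (l' j 0)) -?l'E //.
by apply: contraNneq l'0 => l'j; rewrite l'E l'j scale0r.
Qed.

Lemma dotZl a l rho : dot (a *: l) rho = a * dot l rho.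
Proof. by rewrite mulr_sumr; apply: eq_bigr => i _; rewrite mxE mulrA. Qed.

Lemma dotZr a l rho : dot l (a *: rho) = a * dot l rho.
Proof. by rewrite mulr_sumr; apply: eq_bigr => i _; rewrite mxE mulrCA. Qed.

Lemma dotDr l rho rho' : dot l (rho + rho') = dot l rho + dot l rho'.
Proof. by rewrite -big_split; apply: eq_bigr => i _; rewrite mxE mulrDr. Qed.

Lemma dotDl l l' rho : dot (l + l') rho = dot l rho + dot l' rho.
Proof. by rewrite -big_split; apply: eq_bigr => i _; rewrite mxE mulrDl. Qed.

Lemma dotBl l l' rho : dot (l - l') rho = dot l rho - dot l' rho.
Proof. by rewrite -scaleN1r dotDl dotZl mulN1r. Qed.

Lemma dotBr l rho rho' : dot l (rho - rho') = dot l rho - dot l rho'.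
Proof. by rewrite -scaleN1r dotDr dotZr mulN1r. Qed.

Lemma dot_gt0 l : l != 0 -> 0 < dot l l.
Proof.
move=> /suppN0[i li]; rewrite lt_neqAle sumr_ge0 => [|k _]; last exact: sqr_ge0.
rewrite andbT eq_sym psumr_neq0 => [|k _]; last exact: sqr_ge0.
by apply/hasP; exists i; rewrite ?mem_index_enum //= -expr2 exprn_even_gt0.
Qed.

Lemma ext_semi_activeE rho B j l : is_base A B -> fundamental B j l ->
  ext_semi_active A rho B j <-> j \notin B /\ 0 < dot l rho.
Proof.
move=> bB fl; split=> [[jB [l' [[_ Al'] sub' dl' l'j]]] | [jB dl]].
  split=> //; move: dl' l'j; rewrite (fundamentalP bB fl Al' sub') dotZl inE.
  case: fl => _ _ lj; rewrite mxE lj mulr1 => dl l'j.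
  by rewrite -(pmulr_rgt0 _ l'j).
split=> //; exists l; have [_ sub lj] := fl; split=> //.
  exact: fundamental_circuit fl.
by rewrite inE lj ltr01.
Qed.

(** A dependence on the new set is a multiple of [l] that vanishes at [k], where [l] does not; so it
    is zero. *)
Lemma exchange_base B j l k : is_base A B -> j \notin B ->
  A *m l = 0 -> supp l \subset j |: B -> l k 0 != 0 ->
  is_base A ((j |: B) :\ k).
Proof.
move=> bB jB Al sub lk.
have kU : k \in j |: B by apply: (subsetP sub); rewrite inE.
have lj : l j 0 != 0.
  apply: contraNneq lk => lj; rewrite (base_ker bB Al) ?mxE //.
  apply/suppP => i iB; have [-> // | ij] := eqVneq i j.
  by apply: (suppP _ _ sub); rewrite !inE negb_or ij.
rewrite is_baseE; apply/andP; split.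
  have := cardsU1 j B; rewrite (cardsD1 k) kU jB (base_card bB).
  by move=> /eqP; rewrite eqn_add2l.
apply/free_colsP => l' Al' sub'.
have l'E := base_ker_line bB Al sub lj Al' (subset_trans sub' (subsetDl _ _)).
have l'k : l' k 0 = 0 by apply: (suppP _ _ sub'); rewrite !inE eqxx.
move/eqP: (l'k); rewrite l'E mxE mulf_eq0 (negPf lk) orbF => /eqP ->.
exact: scale0r.
Qed.

End Kernel.

(** * Crossing walls one at a time *)

Section Perturbation.
Variables (R : realType) (N : nat) (I : finType) (v : I -> 'cV[R]_N).
Implicit Types (rho w : 'cV[R]_N) (i p q : I).

Lemma small_multiple (a b : I -> R) :
  exists2 e, 0 < e & forall i, a i != 0 -> e * `|b i| < `|a i|.
Proof.
(* The sum dominates every ratio, and the 1 makes the bounds strict. Indices with [a i = 0]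
   contribute 0, since division by zero gives 0. *)
pose s := 1 + \sum_i `|b i| / `|a i|.
have s_ge i : `|b i| / `|a i| < s.
  rewrite /s (bigD1 i) //= addrCA ltrDl ltr_wpDr ?ltr01 //.
  by apply: sumr_ge0 => k _; rewrite divr_ge0.
have s0 : 0 < s.
  by rewrite ltr_wpDr ?ltr01 // sumr_ge0 // => k _; rewrite divr_ge0.
exists s^-1; first by rewrite invr_gt0.
by move=> i ai; rewrite mulrC ltr_pdivrMr // mulrC -ltr_pdivrMr ?normr_gt0.
Qed.

Lemma sgrD_small (x y : R) : `|y| < `|x| -> Num.sg (x + y) = Num.sg x.
Proof.
by rewrite lter_norml /= => /andP[]; case: (sgrP x) => [-> | x0 | x0];
  rewrite ?normr0; move=> *; [lra | apply: gtr0_sg | apply: ltr0_sg]; lra.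
Qed.

(** In the arrangement of hyperplanes orthogonal to the [v i], the face containing [rho] lies in the
    closure of the face containing [rho']. *)
Definition agree_on_nonzero rho rho' :=
  forall i, dot (v i) rho != 0 ->
    Num.sg (dot (v i) rho') = Num.sg (dot (v i) rho).

Lemma nudge rho w : exists2 e, 0 < e & agree_on_nonzero rho (rho + e *: w).
Proof.
have [e e0 eP] := small_multiple (fun i => dot (v i) rho) (fun i => dot (v i) w).
exists e => // i /eP; rewrite dotDr dotZr => small.
by apply: sgrD_small; rewrite normrM gtr0_norm.
Qed.

Lemma agree_on_nonzero_trans rho1 rho2 rho3 :
  agree_on_nonzero rho1 rho2 -> agree_on_nonzero rho2 rho3 ->
  agree_on_nonzero rho1 rho3.
Proof.
move=> a12 a23 i r1; rewrite a23 ?a12 // -sgr_eq0 a12 // sgr_eq0 //.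
Qed.

Definition off_walls rho := forall i, dot (v i) rho != 0.

Hypothesis v_neq0 : forall i, v i != 0.

Lemma off_walls_near rho :
  exists2 rho', off_walls rho' & agree_on_nonzero rho rho'.
Proof.
suff [rho' off agr] : exists2 rho', {in enum I, forall i, dot (v i) rho' != 0}
    & agree_on_nonzero rho rho'.
  by exists rho' => // i; apply: off; rewrite mem_enum.
elim: (enum I) => [|i s [rho1 off agr]]; first by exists rho.
(* A small move along the normal [v i] leaves wall [i] and does not return to the walls already
   left. *)
have [e e0 agr'] := nudge rho1 (v i).
exists (rho1 + e *: v i); last exact: agree_on_nonzero_trans agr'.
move=> k; rewrite inE; have [r0 /predU1P[-> | ks] | r0 _] :=
  eqVneq (dot (v k) rho1) 0; last by rewrite -sgr_eq0 agr' // sgr_eq0.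
  have [r1|r1] := eqVneq (dot (v i) rho1) 0.
    by rewrite dotDr r1 add0r dotZr mulf_neq0 ?gt_eqF ?dot_gt0.
  by rewrite -sgr_eq0 agr' // sgr_eq0.
by move/eqP: r0 (off _ ks) => ->.
Qed.

Definition same_side i rho rho' := Num.sg (dot (v i) rho) == Num.sg (dot (v i) rho').

(** Gives a detour through [rho1] such that each of its two legs crosses fewer walls than the direct
    segment: start where the segment meets wall [p], move inside that wall off wall [q], then leave
    wall [p] on the suitable side. *)
Lemma separate_walls rho rho' p q : off_walls rho -> off_walls rho' ->
  ~~ same_side p rho rho' -> ~~ same_side q rho rho' ->
  (forall k, v q != k *: v p) ->
  exists rho1, [/\ off_walls rho1,
    forall i, same_side i rho rho' -> same_side i rho rho1
    & (same_side p rho1 rho && same_side q rho1 rho')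
      || (same_side p rho1 rho' && same_side q rho1 rho)].
Proof.
move=> off off' sp sq npar.
pose a := dot (v p) rho; pose a' := dot (v p) rho'.
(* The parameter at which the segment meets wall [p]; it lies strictly between 0 and 1 because the
   ends are on opposite sides. *)
have [s /andP[s0 s1] sa] : exists2 s, 0 < s < 1 & (1 - s) * a + s * a' = 0.
  have a0 : a != 0 := off p; have a'0 : a' != 0 := off' p.
  have aa' : a - a' != 0.
    by rewrite subr_eq0; apply: contraNneq sp; rewrite /same_side -/a -/a' => ->.
  exists (a / (a - a')); last by field.
  move: sp a0 a'0 aa'; rewrite /same_side -/a -/a'.
  case: (sgrP a) => // ha; case: (sgrP a') => // ha'; rewrite ?eqxx // => _ _ _ _.
    by apply/andP; split; [apply: divr_gt0; lra | rewrite ltr_pdivrMr; lra].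
  have -> : a / (a - a') = (- a) / (a' - a) by rewrite -(opprB a) invrN mulrNN.
  by apply/andP; split; [apply: divr_gt0; lra | rewrite ltr_pdivrMr; lra].
pose wall := (1 - s) *: rho + s *: rho'.
have wall_side i : same_side i rho rho' ->
    Num.sg (dot (v i) wall) = Num.sg (dot (v i) rho).
  move: (off i) (off' i); rewrite /same_side dotDr !dotZr.
  case: (sgrP (dot (v i) rho)) => // hi; case: (sgrP (dot (v i) rho')) => // hi' _ _;
    rewrite ?eqxx // => h; try by (exfalso; move/eqP: h; lra).
    by apply: gtr0_sg; nra.
  by apply: ltr0_sg; nra.
have nz_side i : same_side i rho rho' -> dot (v i) wall != 0.
  by move=> si; rewrite -sgr_eq0 wall_side // sgr_eq0.
have wall_p : dot (v p) wall = 0 by rewrite dotDr !dotZr.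
have [wall' [wall'_p wall'_q agr]] : exists wall', [/\ dot (v p) wall' = 0,
    dot (v q) wall' != 0 & agree_on_nonzero wall wall'].
  have [wall_q | wall_q] := eqVneq (dot (v q) wall) 0; last by exists wall.
  (* The component of [v q] orthogonal to [v p]: moving along it stays in wall [p] and leaves wall
     [q]. It is nonzero as [v q] is not a multiple of [v p]. *)
  pose u := v q - (dot (v p) (v q) / dot (v p) (v p)) *: v p.
  have pp : 0 < dot (v p) (v p) by rewrite dot_gt0.
  have pu : dot (v p) u = 0.
    by rewrite dotBr dotZr divfK ?subrr // gt_eqF.
  have u0 : u != 0 by rewrite subr_eq0.
  have qu : dot (v q) u = dot u u.
    by rewrite [in RHS]/u dotBl dotZl pu mulr0 subr0.
  have [e e0 agr] := nudge wall u; exists (wall + e *: u); split=> //.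
    by rewrite dotDr dotZr pu wall_p mulr0 addr0.
  by rewrite dotDr dotZr wall_q add0r mulf_neq0 ?gt_eqF // qu dot_gt0.
have finish (t : R) : t != 0 -> exists rho1, [/\ off_walls rho1,
    forall i, same_side i rho rho' -> same_side i rho rho1,
    Num.sg (dot (v p) rho1) = Num.sg t
    & Num.sg (dot (v q) rho1) = Num.sg (dot (v q) wall')].
  move=> t0; have [e e0 agr1] := nudge wall' (t *: v p).
  have [rho1 off1 agr2] := off_walls_near (wall' + e *: (t *: v p)).
  have agr3 := agree_on_nonzero_trans agr (agree_on_nonzero_trans agr1 agr2).
  exists rho1; split=> // [i si||].
  - by rewrite /same_side agr3 ?nz_side // wall_side.
  - have pp : 0 < dot (v p) (v p) by rewrite dot_gt0.
    have pE : dot (v p) (wall' + e *: (t *: v p)) = e * (t * dot (v p) (v p)).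
      by rewrite dotDr wall'_p add0r !dotZr.
    rewrite agr2 ?pE; first by rewrite !sgrM (gtr0_sg e0) (gtr0_sg pp) mul1r mulr1.
    by rewrite !mulf_eq0 (negPf t0) (gt_eqF e0) (gt_eqF pp).
  - by rewrite (agree_on_nonzero_trans agr1 agr2).
(* Whichever end [wall'] agrees with at [q], the side of [p] is taken from the other end. *)
have [qside | qside] : {Num.sg (dot (v q) wall') = Num.sg (dot (v q) rho)}
    + {Num.sg (dot (v q) wall') = Num.sg (dot (v q) rho')}.
  move: wall'_q (off q) (off' q) sq; rewrite /same_side.
  case: (sgrP (dot (v q) wall')) => // _; case: (sgrP (dot (v q) rho)) => // _;
    case: (sgrP (dot (v q) rho')) => // _; rewrite ?eqxx //;
    by [left | right].
- have [rho1 [off1 side1 p1 q1]] := finish _ (off' p).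
  exists rho1; split=> //; rewrite /same_side q1 p1 qside !eqxx orbT //.
- have [rho1 [off1 side1 p1 q1]] := finish _ (off p).
  exists rho1; split=> //; rewrite /same_side q1 p1 qside !eqxx //.
Qed.

(** Induction on the number of indices whose walls separate the two vectors: two non-parallel
    separating walls allow a detour with fewer on each leg, and otherwise the hypothesis applies. *)
Lemma constant_off_walls (T : Type) (F : 'cV[R]_N -> T) :
  (forall rho rho', off_walls rho -> off_walls rho' ->
    (forall p q, ~~ same_side p rho rho' -> ~~ same_side q rho rho' ->
      exists k, v q = k *: v p) -> F rho = F rho') ->
  forall rho rho', off_walls rho -> off_walls rho' -> F rho = F rho'.
Proof.
move=> Fwall rho rho'.
have [n] := ubnP #|[set i | ~~ same_side i rho rho']|.
elim: n rho rho' => // n IHn rho rho' ltn off off'.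
have [par | /existsNP[p /existsNP[q /not_implyP[sp /not_implyP[sq npar]]]]] :=
  pselect (forall p q, ~~ same_side p rho rho' -> ~~ same_side q rho rho' ->
      exists k, v q = k *: v p); first exact: Fwall.
have [|rho1 [off1 side1 pq1]] := separate_walls off off' sp sq.
  by move=> k; apply/eqP => qk; apply: npar; exists k.
have shrink i (r r' : 'cV[R]_N) : ~~ same_side i rho rho' -> same_side i r r' ->
    (forall k, same_side k rho rho' -> same_side k r r') ->
    (#|[set k | ~~ same_side k r r']| < n)%N.
  move=> si sr sub; apply: leq_trans (ltn : (_ <= n)%N).
  apply/proper_card/properP; split; last by exists i; rewrite !inE ?sr.
  by apply/subsetP => k; rewrite !inE; apply/contraNN/sub.
have sym i r r' : same_side i r r' = same_side i r' r by rewrite /same_side eq_sym.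
have side2 k : same_side k rho rho' -> same_side k rho1 rho'.
  by move=> sk; move: (sk) (side1 _ sk); rewrite /same_side => /eqP <- /eqP ->.
by transitivity (F rho1); case/orP: pq1 => /andP[p1 q1]; apply: IHn => //;
  [apply: (shrink p) | apply: (shrink q) | apply: (shrink q) | apply: (shrink p)];
  rewrite // sym.
Qed.

End Perturbation.

(** * Determinants of adjacent bases *)

Section Determinants.
Variables (R : realType) (d N : nat) (A : 'M[R]_(d, N)).
Implicit Types (B C U : {set 'I_N}) (l rho : 'cV[R]_N) (j k : 'I_N).

(** The Gram matrix depends only on the set of chosen columns, and its determinant is the square of
    theirs; so the absolute determinant does not depend on their order. *)
Lemma gram_colsub (g : 'I_d -> 'I_N) : injective g ->
  colsub g A *m (colsub g A)^T
    = \matrix_(i, i') \sum_(e in [set g k | k : 'I_d]) A i e * A i' e.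
Proof.
move=> ginj; apply/matrixP => i i'; rewrite !mxE big_imset /=; last first.
  by move=> ? ? _ _ /ginj.
by apply: eq_big => [k | k _]; rewrite ?inE // !mxE.
Qed.

Lemma normr_det_eq (n : nat) (M M' : 'M[R]_n) :
  M *m M^T = M' *m M'^T -> `|\det M| = `|\det M'|.
Proof.
move=> /(congr1 determinant); rewrite !det_mulmx !det_tr -!expr2 => eq2.
by rewrite -!sqrtr_sqr eq2.
Qed.

Definition enum_base B (cB : #|B| = d) (k : 'I_d) : 'I_N :=
  enum_val (cast_ord (esym cB) k).

Lemma enum_base_inj B (cB : #|B| = d) : injective (enum_base cB).
Proof. by move=> k k' /enum_val_inj/cast_ord_inj. Qed.

Lemma enum_base_onto B (cB : #|B| = d) j : j \in B ->
  exists m, enum_base cB m = j.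
Proof.
move=> jB; exists (cast_ord cB (enum_rank_in jB j)).
by rewrite /enum_base cast_ordK enum_rankK_in.
Qed.

Lemma det_colsE B (cB : #|B| = d) : det_cols A B = \det (colsub (enum_base cB) A).
Proof.
congr (\det _); apply/matrixP => i k; rewrite !mxE.
set k' := cast_ord (esym cB) k.
by rewrite -[X in nth _ _ X]/(nat_of_ord k') (nth_image 0) mxE.
Qed.

Lemma enum_base_image B (cB : #|B| = d) : [set enum_base cB k | k : 'I_d] = B.
Proof.
apply/setP => j; apply/imsetP/idP => [[k _ ->] | jB]; first exact: enum_valP.
by have [k kj] := enum_base_onto cB jB; exists k.
Qed.

Lemma normr_det_cols B (g : 'I_d -> 'I_N) :
  injective g -> [set g k | k : 'I_d] = B -> `|det_cols A B| = `|\det (colsub g A)|.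
Proof.
move=> ginj gB; have cB : #|B| = d by rewrite -gB card_imset ?card_ord.
rewrite (det_colsE cB); apply: normr_det_eq.
by rewrite !gram_colsub ?enum_base_image ?gB //; apply: enum_base_inj.
Qed.

Lemma det_replace_col (n : nat) (k0 : 'I_n) (c : 'I_n -> R) :
  \det (\matrix_(i, k) (if k == k0 then c i else (i == k)%:R)) = c k0.
Proof.
rewrite (expand_det_row _ k0) (bigD1 k0) //= big1 ?addr0 => [|k kk0]; last first.
  by rewrite mxE (negPf kk0) eq_sym (negPf kk0) mul0r.
rewrite mxE eqxx /cofactor -signr_odd oddD addbb expr0 mul1r.
rewrite -[X in \det X](_ : 1%:M = _) ?det1 ?mulr1 //.
apply/matrixP => i k; rewrite !mxE (inj_eq lift_inj).
by rewrite [_ == k0]eq_sym (negPf (neq_lift _ _)).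
Qed.

(** Cramer's rule: the dependence [l] writes column [j] in terms of the base columns, and replacing
    column [k] by column [j] multiplies the determinant by the coefficient of column [k]. *)
Lemma det_exchange B j l k : is_base A B -> j \notin B ->
  A *m l = 0 -> supp l \subset j |: B -> k \in j |: B ->
  `|det_cols A ((j |: B) :\ k)| * `|l j 0| = `|det_cols A B| * `|l k 0|.
Proof.
move=> bB jB Al sub; rewrite !inE => /predU1P[-> | kB].
  by rewrite setU1K.
have kj : k != j by apply: contraNneq jB => <-.
have cB := base_card bB.
have [k0 k0k] := enum_base_onto cB kB; set g := enum_base cB in k0k.
have ginj : injective g by apply: enum_base_inj.
have gB i : g i \in B by apply: enum_valP.
pose g' i := if i == k0 then j else g i.
have g'inj : injective g'.
  move=> i i'; rewrite /g'; case: (eqVneq i k0) => [->|_];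
    case: (eqVneq i' k0) => [->|_] //.
  - by move=> jg; rewrite jg gB in jB.
  - by move=> jg; rewrite -jg gB in jB.
  - exact: ginj.
have g'U : [set g' i | i : 'I_d] = (j |: B) :\ k.
  apply/setP => i; rewrite !inE; apply/imsetP/andP => [[m _ ->] | [ik ijB]].
    rewrite /g'; case: (eqVneq m k0) => [_|mk0]; first by rewrite (eq_sym j k) kj eqxx.
    by rewrite -k0k (inj_eq ginj) gB orbT.
  case/predU1P: ijB => [-> | iB]; first by exists k0; rewrite // /g' eqxx.
  have [m mi] := enum_base_onto cB iB; exists m; rewrite // /g'.
  by case: (eqVneq m k0) => // mk0; rewrite -mi mk0 -/g k0k eqxx in ik.
rewrite (normr_det_cols g'inj g'U) (normr_det_cols ginj (enum_base_image cB)).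
have [lj | lj] := eqVneq (l j 0) 0.
  rewrite (base_ker bB Al) ?mxE ?normr0 ?mulr0 //.
  apply/suppP => i iB; have [-> // | ij] := eqVneq i j.
  by apply: (suppP _ _ sub); rewrite !inE negb_or ij.
(* The second factor is the identity with column [k0] replaced by the coordinates of column [j] in
   the base. *)
have -> : colsub g' A = colsub g A *m
    \matrix_(i, m) (if m == k0 then - l (g i) 0 / l j 0 else (i == m)%:R).
  apply/matrixP => i m; rewrite !mxE /g'; case: (eqVneq m k0) => [->|mk0]; last first.
    rewrite (bigD1 m) //= big1 ?addr0 => [|m' m'm]; rewrite !mxE (negPf mk0).
      by rewrite eqxx mulr1.
    by rewrite (negPf m'm) mulr0.
  have := congr1 (fun M : 'cV_d => M i 0) Al.
  rewrite mulmx_sum_col (sum_supp _ sub) big_setU1 //= !mxE summxE.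
  rewrite -{1}(enum_base_image cB) big_imset /=; last by move=> ? ? _ _ /ginj.
  move=> /eqP; rewrite addr_eq0 => /eqP Aj; apply: (mulfI lj); rewrite Aj.
  rewrite mulr_sumr -sumrN; apply: eq_big => [m'|m' _]; first by rewrite inE.
  by rewrite !mxE eqxx -/g; field.
rewrite det_mulmx det_replace_col k0k normrM -mulrA; congr (_ * _).
by rewrite mulNr normrN normrM normfV divfK ?normr_eq0.
Qed.

End Determinants.

(** * Independence of the generic vector *)

(* On a wall the two fundamental dependences through an element outside [U]
   differ by a multiple of the vanishing one. *)
Lemma same_sign (R : realFieldType) (x x' y y' c z z' : R) :
  x != 0 -> x' != 0 -> y != 0 -> y' != 0 -> z != 0 -> z' != 0 ->
  (0 < x) = (0 < x') -> (0 < y) = (0 < y') -> (0 < z) != (0 < z') ->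
  x - y = c * z -> x' - y' = c * z' -> (0 < x) = (0 < y).
Proof.
move=> x0 x'0 y0 y'0 z0 z'0 xx' yy' zz' e e'.
(* The right-hand side is at most 0. If [x] and [y] had opposite signs, [x'] and [y'] would have the
   same respective signs, making both differences nonzero of equal sign. *)
have prod : (x - y) * (x' - y') = c ^+ 2 * (z * z') by rewrite e e'; ring.
have neg : z * z' < 0.
  case: (ltrgt0P z) z0 zz' => // hz _; case: (ltrgt0P z') z'0 => // hz' _ _.
    by rewrite pmulr_rlt0.
  by rewrite nmulr_rlt0.
have {}neg : (x - y) * (x' - y') <= 0 by rewrite prod mulr_ge0_le0 ?sqr_ge0 ?ltW.
case: (ltrgt0P x) x0 xx' => // hx _; case: (ltrgt0P x') x'0 => // hx' _ _;
  case: (ltrgt0P y) y0 yy' => // hy _; case: (ltrgt0P y') y'0 => // hy' _ _;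
  exfalso; move: neg; apply/negP; rewrite -ltNge.
  by apply: mulr_gt0; lra.
by rewrite nmulr_rgt0; lra.
Qed.

Section Invariance.
Variables (R : realType) (d N : nat) (A : 'M[R]_(d, N)).
Implicit Types (B C U : {set 'I_N}) (l rho : 'cV[R]_N) (j k : 'I_N).

Lemma flat_ker_sum l : flat A -> A *m l = 0 -> \sum_i l i 0 = 0.
Proof.
case=> h hA Al; have := congr1 (fun M : 'M_1 => M 0 0) (mulmxA h A l).
rewrite Al mulmx0 !mxE => sum0; rewrite [RHS]sum0.
by apply: eq_bigr => i _; rewrite hA mul1r.
Qed.

Variable fc : {set 'I_N} -> 'I_N -> 'cV[R]_N.
Hypothesis fcP : forall B j, is_base A B -> j \notin B -> fundamental A B j (fc B j).

Definition active rho B j := 0 < dot (fc B j) rho.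

Lemma ext_active rho B : is_base A B ->
  ext A rho B = #|[set j | (j \notin B) && active rho B j]|.
Proof.
move=> bB; apply: eq_card => j; rewrite !inE; apply/asboolP/andP.
  move=> act; have jB : j \notin B by case: act.
  by have [] := (ext_semi_activeE rho bB (fcP bB jB)).1 act.
by move=> [jB dl]; apply/(ext_semi_activeE rho bB (fcP bB jB)).
Qed.

(** * Change of the polynomial across a single wall *)

Section Wall.
Variables rho rho' : 'cV[R]_N.

Let crossing B j :=
  [&& is_base A B, j \notin B & active rho B j != active rho' B j].

Hypothesis off : forall B j, is_base A B -> j \notin B -> dot (fc B j) rho != 0.
Hypothesis off' : forall B j, is_base A B -> j \notin B -> dot (fc B j) rho' != 0.
Hypothesis one_wall : forall B j B' j', crossing B j -> crossing B' j' ->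
  exists a, fc B' j' = a *: fc B j.

(** The vectors of two crossing elements would be parallel, but the one for [k] is 1 at [k], where
    the one for [j] vanishes. *)
Lemma crossing_once B j k : crossing B j -> k != j -> ~~ crossing B k.
Proof.
move=> cj kj; apply/negP => ck; have [a fck] := one_wall cj ck.
have /and3P[bB jB _] := cj; have /and3P[_ kB _] := ck.
have [_ sub _] := fcP bB jB; have [_ _] := fcP bB kB.
rewrite fck mxE (suppP _ _ sub k) ?mulr0; last by rewrite !inE negb_or kj.
by move/eqP; rewrite eq_sym oner_eq0.
Qed.

Let change B : {poly R} :=
  `|det_cols A B| *: ('X^(ext A rho B) - 'X^(ext A rho' B)).

Lemma change0 B : is_base A B -> (forall j, ~~ crossing B j) -> change B = 0.
Proof.
move=> bB noc; rewrite /change !ext_active //.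
suff -> : [set j | (j \notin B) && active rho B j]
  = [set j | (j \notin B) && active rho' B j] by rewrite subrr scaler0.
apply/setP => j; rewrite !inE; case jB: (j \in B) => //=.
by have := noc j; rewrite /crossing bB jB /= negbK => /eqP.
Qed.

Lemma change_sum :
  \sum_(B | is_base A B) change B = \sum_(p | crossing p.1 p.2) change p.1.
Proof.
rewrite -(pair_big_dep xpredT crossing (fun B _ => change B)) /=.
rewrite big_mkcond; apply: eq_bigr => B _; case: ifP => bB; last first.
  by rewrite big_pred0 // => j; rewrite /crossing bB.
have [/existsP[j cj]|/existsPn noc] := boolP [exists j, crossing B j].
  rewrite (bigD1 j) //= big1 ?addr0 // => k /andP[ck kj].
  by have := crossing_once cj kj; rewrite ck.
by rewrite change0 // big1.
Qed.

(** Groups the crossing pairs by [U = j |: B]; within one group the changes will cancel. *)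
Lemma change_sum_circuits : \sum_(p | crossing p.1 p.2) change p.1
  = \sum_(U : {set 'I_N}) \sum_(j | (j \in U) && crossing (U :\ j) j) change (U :\ j).
Proof.
rewrite (pair_big_dep xpredT) /=.
rewrite (reindex_onto (fun p : {set 'I_N} * 'I_N => (p.1 :\ p.2, p.2))
  (fun p => (p.2 |: p.1, p.2))) /=; last first.
  by case=> B j /= /and3P[_ jB _]; rewrite setU1K.
apply: eq_bigl => -[U j] /=; rewrite andbC; congr (_ && _).
rewrite xpair_eqE eqxx andbT; apply/eqP/idP => [<- | jU].
  by rewrite setU11.
by rewrite setD1K.
Qed.

(** * The affected bases inside one fixed set [U] *)

Variables (U : {set 'I_N}) (j0 : 'I_N).
Hypotheses (j0U : j0 \in U) (cj0 : crossing (U :\ j0) j0).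
Let lam := fc (U :\ j0) j0.

Let j0base : is_base A (U :\ j0). Proof. by case/and3P: cj0. Qed.
Let j0fresh : j0 \notin U :\ j0. Proof. by rewrite !inE eqxx. Qed.
Let lam_fund : fundamental A (U :\ j0) j0 lam. Proof. exact: fcP. Qed.
Let lam_ker : A *m lam = 0. Proof. by case: lam_fund. Qed.
Let lam_supp : supp lam \subset U.
Proof. by case: lam_fund => _; rewrite setD1K. Qed.

Lemma base_wall j : lam j 0 != 0 -> is_base A (U :\ j).
Proof.
move=> lj; rewrite -(setD1K j0U); apply: exchange_base lj => //.
by rewrite setD1K.
Qed.

Lemma supp_wall j : lam j 0 != 0 -> j \in U.
Proof. by move=> lj; apply: (subsetP lam_supp); rewrite inE. Qed.

Lemma ker_wall l : A *m l = 0 -> supp l \subset U -> l = l j0 0 *: lam.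
Proof.
by move=> Al sub; apply: (fundamentalP j0base lam_fund) => //; rewrite setD1K.
Qed.

Lemma fc_wall j : lam j 0 != 0 -> fc (U :\ j) j = (lam j 0)^-1 *: lam.
Proof.
move=> lj; have jU := supp_wall lj; have bj := base_wall lj.
have jfresh : j \notin U :\ j by rewrite !inE eqxx.
have [Af subf fj] := fcP bj jfresh.
rewrite setD1K // in subf.
have fE := ker_wall Af subf; move: fE fj; move: (fc _ _ j0 0) => c ->.
rewrite mxE => cl; congr (_ *: _); apply: (mulIf lj); rewrite cl mulVf //.
Qed.

Lemma active_wall r j : lam j 0 != 0 ->
  active r (U :\ j) j = (0 < lam j 0 * dot lam r).
Proof.
move=> lj; rewrite /active fc_wall // dotZl.
by rewrite -(pmulr_rgt0 _ (x := lam j 0 ^+ 2)) ?exprn_even_gt0 // expr2 -mulrA mulVKf.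
Qed.

(** The activity of [j] is the sign of [lam j 0 * dot lam r], so it changes for every [j] in the
    support of [lam] as soon as it changes for [j0]. Conversely, a crossing vector is a multiple of
    [lam] and equals 1 at [j]. *)
Lemma crossing_wall j :
  (j \in U) && crossing (U :\ j) j = (lam j 0 != 0).
Proof.
apply/andP/idP => [[jU cj] | lj]; last first.
  rewrite supp_wall // /crossing base_wall // !inE eqxx /=; split=> //.
  have := active_wall rho lj; have := active_wall rho' lj => -> ->.
  have /and3P[_ _] := cj0; rewrite /active -/lam => neq.
  have := off j0base j0fresh; have := off' j0base j0fresh; rewrite -/lam => d1 d2.
  apply: contra neq => /eqP; case: (ltrgt0P (lam j 0)) lj => // lj _.
    by rewrite !pmulr_rgt0 // => ->.
  rewrite !nmulr_rgt0 // => eqs; move: eqs d1 d2.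
  by case: (ltrgt0P (dot lam rho)) => //; case: (ltrgt0P (dot lam rho')).
have [a fcE] := one_wall cj0 cj; have /and3P[bj _ _] := cj.
have jfresh : j \notin U :\ j by rewrite !inE eqxx.
have [_ _] := fcP bj jfresh; rewrite fcE mxE => alj.
by apply: contra_eq_neq alj => ->; rewrite mulr0 eq_sym oner_neq0.
Qed.

Lemma not_crossing_wall j k : lam j 0 != 0 -> k \notin U ->
  active rho (U :\ j) k = active rho' (U :\ j) k.
Proof.
move=> lj kU; have /andP[_ cj] : (j \in U) && crossing (U :\ j) j.
  by rewrite crossing_wall.
have kj : k != j by apply: contraNneq kU => ->; apply: supp_wall.
have := crossing_once cj kj; rewrite /crossing base_wall //= negb_and !negbK.
by rewrite !inE (negPf kU) andbF /= => /eqP.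
Qed.

(** The two fundamental vectors of [k] differ by a kernel vector supported in [U], a multiple of
    [lam]. Pairing with [lam] changes sign across the wall while the activities of [k] do not, so
    [same_sign] applies. *)
Lemma active_wall_const j k : lam j 0 != 0 -> k \notin U ->
  active rho (U :\ j) k = active rho (U :\ j0) k.
Proof.
move=> lj kU.
have lj0 : lam j0 0 != 0 by case: lam_fund => _ _ ->; rewrite oner_neq0.
have kB i : k \notin U :\ i by rewrite !inE (negPf kU) andbF.
have bj := base_wall lj; have [Aj subj kj] := fcP bj (kB j).
have [A0 sub0 k0] := fcP j0base (kB j0).
have jU := supp_wall lj.
pose g := fc (U :\ j) k - fc (U :\ j0) k.
have gE : g = g j0 0 *: lam.
  apply: ker_wall; first by rewrite mulmxBr Aj A0 subrr.
  apply/suppP => i iU; rewrite !mxE; have [-> | ik] := eqVneq i k.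
    by rewrite kj k0 subrr.
  rewrite (suppP _ _ subj) ?(suppP _ _ sub0) ?subrr //.
    by rewrite !inE (negPf ik) (negPf iU) andbF.
  by rewrite !inE (negPf ik) (negPf iU) andbF.
have dE r : dot (fc (U :\ j) k) r - dot (fc (U :\ j0) k) r = g j0 0 * dot lam r.
  by rewrite -dotBl -/g {1}gE dotZl.
apply: (same_sign _ _ _ _ _ _ _ _ _ (dE rho) (dE rho')).
- exact: off bj (kB j).
- exact: off' bj (kB j).
- exact: off j0base (kB j0).
- exact: off' j0base (kB j0).
- exact: off j0base j0fresh.
- exact: off' j0base j0fresh.
- exact: not_crossing_wall.
- exact: not_crossing_wall.
- by case/and3P: cj0.
Qed.

Lemma ext_wall r j : lam j 0 != 0 ->
  ext A r (U :\ j)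
    = (#|[set k | (k \notin U) && active r (U :\ j) k]| + active r (U :\ j) j)%N.
Proof.
move=> lj; have jU := supp_wall lj; rewrite ext_active ?base_wall //.
rewrite (cardsD1 j) !inE eqxx /= addnC; congr (_ + _)%N; apply: eq_card => k.
rewrite !inE; case: eqVneq => [-> | kj] //=.
by rewrite jU.
Qed.

Lemma wall_sum : flat A ->
  \sum_(j | (j \in U) && crossing (U :\ j) j) change (U :\ j) = 0.
Proof.
move=> flA; rewrite (eq_bigl _ _ crossing_wall).
pose e := #|[set k | (k \notin U) && active rho (U :\ j0) k]|.
pose w := `|det_cols A (U :\ j0)|.
have lj0 : lam j0 0 = 1 by case: lam_fund.
(* The weight is [w] times the absolute value of [lam j 0], and the difference of powers has the
   sign of [lam j 0 * dot lam rho]. Together the change is linear in [lam j 0], so flatness makes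
   the sum vanish. *)
have changeE j : lam j 0 != 0 -> change (U :\ j)
    = lam j 0 *: ((w * Num.sg (dot lam rho)) *: ('X^e * ('X - 1))).
  move=> lj; rewrite /change !ext_wall //.
  have <- : e = #|[set k | (k \notin U) && active rho (U :\ j) k]|.
    apply: eq_card => k; rewrite !inE; case kU: (k \in U) => //=.
    by rewrite active_wall_const // kU.
  have <- : e = #|[set k | (k \notin U) && active rho' (U :\ j) k]|.
    apply: eq_card => k; rewrite !inE; case kU: (k \in U) => //=.
    by rewrite -not_crossing_wall ?kU // active_wall_const // kU.
  have -> : `|det_cols A (U :\ j)| = w * `|lam j 0|.
    have := det_exchange j0base j0fresh lam_ker.
    by rewrite setD1K // => /(_ j lam_supp (supp_wall lj)); rewrite lj0 normr1 mulr1.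
  have := crossing_wall j; rewrite lj => /andP[_ /and3P[_ _ neq]].
  have -> : active rho' (U :\ j) j = ~~ active rho (U :\ j) j.
    by move: neq; do 2!case: active.
  have := off j0base j0fresh; rewrite -/lam active_wall //.
  move=> L0; rewrite !exprD -mulrBr -scalerA [RHS]scalerA [_ * (w * _)]mulrCA.
  rewrite -[RHS]scalerA !scalerAr.
  case: (ltrgt0P (lam j 0)) lj => // hl _; case: (ltrgt0P (dot lam rho)) L0 => // hL _;
    congr (_ * (w *: _)).
  - by rewrite mulr_gt0 //= gtr0_sg // mulr1.
  - by rewrite pmulr_rgt0 // ltNge ltW //= ltr0_sg // mulrN1 scaleNr -scalerN opprB.
  - by rewrite nmulr_rgt0 // ltNge ltW //= gtr0_sg // mulr1 scaleNr -scalerN opprB.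
  - by rewrite nmulr_rgt0 // hL /= ltr0_sg // mulrN1.
rewrite (eq_bigr _ changeE) -scaler_suml big_mkcond /=.
rewrite (eq_bigr (fun i => lam i 0)) => [|i _]; last first.
  by case: eqVneq => [->|].
by rewrite (flat_ker_sum flA lam_ker) scale0r.
Qed.

End Wall.

End Invariance.

Theorem ext_poly_indep (R : realType) (d N : nat) (A : 'M[R]_(d, N)) :
  flat A -> forall rho rho', generic A rho -> generic A rho' ->
  ext_poly A rho = ext_poly A rho'.
Proof.
move=> flA.
have /choice[fc' fcP'] : forall p : {set 'I_N} * 'I_N, exists l,
    is_base A p.1 -> p.2 \notin p.1 -> fundamental A p.1 p.2 l.
  case=> B j /=; have [bB|nB] := boolP (is_base A B); last by exists 0.
  have [jB|njB] := boolP (j \notin B); last by exists 0.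
  by have [l fl] := ex_fundamental bB jB; exists l.
pose fc B j := fc' (B, j).
have fcP B j : is_base A B -> j \notin B -> fundamental A B j (fc B j).
  exact: (fcP' (B, j)).
(* The walls are indexed by a base and an element outside it; their normals are the fundamental
   vectors, which are circuit vectors, so generic vectors avoid them. *)
pose I := {p : {set 'I_N} * 'I_N | is_base A p.1 && (p.2 \notin p.1)}.
pose v (i : I) := fc (val i).1 (val i).2.
have v0 i : v i != 0.
  by case: i => -[B j] /= ij;
    case/andP: (ij) => bB jB; apply: fundamental_neq0 (fcP B j bB jB).
have genv rho : generic A rho -> off_walls v rho.
  move=> gen [[B j] ij]; case/andP: (ij) => bB jB; apply: gen.
  exact: fundamental_circuit (fcP _ _ bB jB).
move=> rho rho' /genv off /genv off'.
apply: (constant_off_walls v0 _ off off') => {off off'}rho {}rho' off off' par.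
have offB r : off_walls v r -> forall B j, is_base A B -> j \notin B ->
    dot (fc B j) r != 0.
  move=> offr B j bB jB.
  have ij : is_base A (B, j).1 && ((B, j).2 \notin (B, j).1) by rewrite bB.
  exact: (offr (exist _ (B, j) ij)).
apply/eqP; rewrite -subr_eq0; apply/eqP.
rewrite -sumrB (eq_bigr _ (fun B _ => esym (scalerBr _ _ _))).
have one_wall B j B' j' :
    [&& is_base A B, j \notin B & active fc rho B j != active fc rho' B j] ->
    [&& is_base A B', j' \notin B' & active fc rho B' j' != active fc rho' B' j'] ->
    exists a, fc B' j' = a *: fc B j.
  case/and3P => bB jB neq /and3P[bB' jB' neq'].
  have ij : is_base A (B, j).1 && ((B, j).2 \notin (B, j).1) by rewrite bB.
  have ij' : is_base A (B', j').1 && ((B', j').2 \notin (B', j').1) by rewrite bB'.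
  have side i : (0 < dot (v i) rho) != (0 < dot (v i) rho') ->
      ~~ same_side v i rho rho'.
    by apply: contra => /eqP eqs; rewrite -sgr_gt0 eqs sgr_gt0.
  by apply: (par (exist _ (B, j) ij) (exist _ (B', j') ij')); apply: side.
rewrite (change_sum fcP one_wall) change_sum_circuits.
apply: big1 => U _.
have [/existsP[j0 /andP[jU cj0]] | /existsPn noc] := boolP [exists j, (j \in U) &&
  [&& is_base A (U :\ j), j \notin U :\ j
    & active fc rho (U :\ j) j != active fc rho' (U :\ j) j]].
  exact: (wall_sum fcP (offB _ off) (offB _ off') one_wall jU cj0).
by apply: big1 => j jc; have := noc j; rewrite jc.
Qed.

(** * Potentials and spanning trees *)

Lemma connect_invariant (T : finType) (e : rel T) (P : T -> Prop) x y :
  (forall u v, e u v -> P u -> P v) -> connect e x y -> P x -> P y.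
Proof.
move=> closP /connectP[p ep ->] {y}.
elim: p x ep => //= z p IHp x /andP[exz ep] Px.
by apply: IHp ep (closP _ _ exz Px).
Qed.

Lemma connect_crossing (T : finType) (e : rel T) (P : pred T) x y :
  connect e x y -> P x -> ~~ P y ->
  exists u v, [/\ P u, ~~ P v, e u v & connect e v y].
Proof.
move=> /connectP[p ep ->] {y}.
elim: p x ep => /= [x _ -> // | z p IHp x /andP[exz ep] Px nP].
have [Pz | nPz] := boolP (P z); first exact: IHp ep Pz nP.
by exists x, z; split=> //; apply/connectP; exists p.
Qed.

Section Potentials.
Variables (R : realType) (D : digraph).
Let V := dvertex D.
Let N := #|dedge D|.
Implicit Types (T S X : {set dedge D}) (u v r : V) (e f : dedge D).
Implicit Types (phi : V -> R) (k : 'I_N).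

Definition delta phi : 'cV[R]_N :=
  \col_k (phi (src (enum_val k)) - phi (tgt (enum_val k))).

Definition const_along T phi := forall e, e \in T -> phi (src e) = phi (tgt e).

Lemma mulmx_incidence (x : 'rV[R]_#|V|) :
  x *m incidence_mx D R = (delta (fun v => x 0 (enum_rank v)))^T.
Proof.
apply/rowP => k; rewrite !mxE.
rewrite (reindex _ (onW_bij _ (@enum_rank_bij V))) /=.
under eq_bigr => v _ do rewrite mxE enum_rankK mulrBr !mulr_natr !mulrb.
by rewrite sumrB -!big_mkcond !big_pred1_eq.
Qed.

Lemma delta_row phi :
  (delta phi)^T = (\row_i phi (enum_val i)) *m incidence_mx D R.
Proof.
rewrite mulmx_incidence; congr (_^T); apply/colP => k.
by rewrite !mxE !enum_rankK.
Qed.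

Lemma delta_eq0 phi : delta phi = 0 <-> const_along setT phi.
Proof.
split=> [d0 e _ | phiT].
  have := congr1 (fun M : 'cV_N => M (enum_rank e) 0) d0.
  by rewrite !mxE enum_rankK => /eqP; rewrite subr_eq0 => /eqP.
by apply/colP => k; rewrite !mxE phiT ?subrr ?inE.
Qed.

Lemma adj_const T phi u v : const_along T phi -> adj_in T u v -> phi u = phi v.
Proof.
move=> phiT /existsP[e /andP[eT]].
by case/orP=> /andP[/eqP<- /eqP<-]; rewrite phiT.
Qed.

Lemma connect_const T phi u v :
  const_along T phi -> connect (adj_in T) u v -> phi u = phi v.
Proof.
move=> phiT uv; apply: (connect_invariant (P := fun w => phi u = phi w) _ uv erefl).
by move=> x y /(adj_const phiT) <-.
Qed.

Lemma adj_src_tgt T e : e \in T -> adj_in T (src e) (tgt e).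
Proof. by move=> eT; apply/existsP; exists e; rewrite eT !eqxx. Qed.

Lemma adj_tgt_src T e : e \in T -> adj_in T (tgt e) (src e).
Proof. by move=> eT; apply/existsP; exists e; rewrite eT !eqxx orbT. Qed.

Lemma connect_edge T u e : e \in T ->
  connect (adj_in T) u (src e) = connect (adj_in T) u (tgt e).
Proof.
move=> eT; apply/idP/idP => c; apply: (connect_trans c); apply: connect1.
  exact: adj_src_tgt.
exact: adj_tgt_src.
Qed.

(** Makes connectivity a linear condition on potentials. Conversely, it is tested on the indicator
    of the component of [u]. *)
Lemma spanning_connectedP T : spanning_connected T <->
  (forall phi, const_along T phi -> forall u v, phi u = phi v).
Proof.
split=> [/forallP cT phi phiT u v | phic].
  by apply: connect_const phiT _; have /forallP := cT u.
apply/forallP => u; apply/forallP => v.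
have uT : const_along T (fun w => (connect (adj_in T) u w)%:R).
  by move=> e eT; rewrite (connect_edge u eT).
have /eqP := phic _ uT u v; rewrite connect0 eqr_nat.
by case: connect.
Qed.

(** The left kernel consists of the potentials with zero coboundary, which connectivity forces to be
    constant. *)
Lemma rank_incidence r : spanning_connected [set: dedge D] ->
  \rank (incidence_mx D R) = #|V|.-1.
Proof.
move=> /spanning_connectedP conn.
have n0 : (0 < #|V|)%N by apply/card_gt0P; exists r.
have : \rank (kermx (incidence_mx D R)) = 1%N.
  have -> : 1%N = \rank (const_mx 1 : 'rV[R]_#|V|).
    rewrite rank_rV; case: eqP => // /rowP /(_ (enum_rank r)) /eqP.
    by rewrite !mxE oner_eq0.
  apply/eqmx_rank/andP; split; last first.
    apply/sub_kermxP; rewrite mulmx_incidence; apply/rowP => k.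
    by rewrite !mxE subrr.
  apply/row_subP => i; set x := row i _.
  have : x *m incidence_mx D R = 0.
    by rewrite -row_mul mulmx_ker row0.
  clearbody x.
  rewrite mulmx_incidence => /(congr1 trmx); rewrite trmxK trmx0.
  move=> /delta_eq0 /conn xc.
  suff -> : x = x 0 (enum_rank r) *: const_mx 1 by apply: scalemx_sub.
  apply/rowP => j; rewrite ![in RHS]mxE mulr1.
  by have := xc (enum_val j) r; rewrite enum_valK.
rewrite mxrank_ker => /eqP; have := rank_leq_row (incidence_mx D R).
move: (\rank _) => m; case: (#|V|) n0 => // n _.
by move=> mn; rewrite -(eqn_add2r m) subnK // add1n eqSS => /eqP ->.
Qed.

End Potentials.

(** * Spanning trees and their reversals *)

Section Trees.
Variables (R : realType) (D : digraph).
Let V := dvertex D.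
Implicit Types (T S X : {set dedge D}) (u v r : V) (e f : dedge D).

Definition subgraph T : digraph :=
  @Digraph (dvertex D) {e : dedge D | e \in T} (fun x => src (val x))
    (fun x => tgt (val x)).

Lemma subgraph_connected T :
  spanning_connected T -> spanning_connected [set: dedge (subgraph T)].
Proof.
move=> /(spanning_connectedP R) conn; apply/(spanning_connectedP R) => phi phiT.
apply: conn => e eT.
exact: (phiT (exist _ e eT : dedge (subgraph T)) (in_setT _)).
Qed.

Lemma rank_subgraph r T : spanning_connected T ->
  \rank (incidence_mx (subgraph T) R) = #|V|.-1.
Proof.
by move=> /subgraph_connected conn; apply: (rank_incidence (D := subgraph T) R r).
Qed.

Lemma card_connected r T : spanning_connected T -> (#|V|.-1 <= #|T|)%N.
Proof.
move=> conn; rewrite -(rank_subgraph r conn).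
by apply: leq_trans (rank_leq_col _) _; rewrite /= card_sig.
Qed.

(** For a tree [T], the source side of the fundamental cut of [e]. *)
Definition side T e v := connect (adj_in (T :\ e)) (src e) v.

Lemma side_src T e : side T e (src e).
Proof. exact: connect0. Qed.

Lemma side_tgt T e : acyclic T -> e \in T -> ~~ side T e (tgt e).
Proof. by move=> /forallP /(_ e) /implyP. Qed.

Lemma side_edge T e f : f \in T -> f != e -> side T e (src f) = side T e (tgt f).
Proof. by move=> fT fe; apply: connect_edge; rewrite !inE fe. Qed.

(** The coboundary in [T] of the indicator of a side is a unit vector, so the incidence matrix of
    [T] has independent columns. *)
Lemma card_acyclic r T : spanning_tree T -> (#|T| <= #|V|.-1)%N.
Proof.
case/andP=> conn acyc; rewrite -(rank_subgraph r conn).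
have <- : #|dedge (subgraph T)| = #|T| by rewrite /= card_sig.
rewrite -[X in (X <= _)%N](mxrank1 R); apply: mxrankS.
apply/row_subP => k; rewrite rowE mulmx1.
pose phi v : R := (side T (val (enum_val k)) v)%:R.
suff -> : delta_mx 0 k = (delta (D := subgraph T) phi)^T.
  by rewrite delta_row submxMl.
apply/rowP => k'; rewrite !mxE /= /phi; have [-> | k'k] := eqVneq k' k.
  by rewrite side_src (negPf (side_tgt acyc (valP _))) subr0.
rewrite side_edge ?subrr //; first exact: valP.
by apply: contra_neq k'k => /val_inj/enum_val_inj.
Qed.

Lemma spanning_treeE r T :
  spanning_tree T = spanning_connected T && (#|T| == #|V|.-1).
Proof.
apply/idP/andP => [tree | [conn /eqP cT]].
  have /andP[conn _] := tree; split=> //.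
  by rewrite eqn_leq (card_acyclic r) // (card_connected r).
apply/andP; split=> //; apply/forallP => e; apply/implyP => eT.
apply/negP => eC.
(* If the ends of [e] stay connected without [e], then [T :\ e] is connected with too few edges. *)
suff /(card_connected r) : spanning_connected (T :\ e).
  by rewrite -cT (cardsD1 e T) eT ltnn.
apply/(spanning_connectedP R) => phi phiT.
apply: ((spanning_connectedP R T).1 conn phi) => f fT.
have [-> | fe] := eqVneq f e; first exact: connect_const phiT eC.
by apply: phiT; rewrite !inE fe.
Qed.

Definition away r T := [set e in T | side T e r].

(** Each edge of the tree must point towards the side containing [r], so the set of reversed edges
    is forced. *)
Lemma reversal_away r T S : spanning_tree T -> S \subset T ->
  [forall v, connect (step_reversing T S) v r] = (S == away r T).
Proof.
case/andP=> conn acyc sub.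
(* In [leave] and [enter], [e] is the only edge of [T] between its two sides: a directed path
   changing sides uses it, which decides whether [e] is reversed, and the path continues from its
   far end. *)
have leave e v w : e \in T -> connect (step_reversing T S) v w ->
    side T e v -> ~~ side T e w -> e \notin S /\ connect (step_reversing T S) (tgt e) w.
  move=> eT vw sv sw; have [x [y [sx sy /existsP[f /andP[fT step]] yw]]] :=
    connect_crossing vw sv sw.
  have [fe | fe] := eqVneq f e; last first.
    by move: step sx sy; case: ifP => _ /andP[/eqP<- /eqP<-];
      rewrite side_edge // => ->.
  move: step sx sy yw; rewrite fe; case: ifP => eS /andP[/eqP<- /eqP<-] //.
  by rewrite (negPf (side_tgt acyc eT)).
have enter e v w : e \in T -> connect (step_reversing T S) v w ->
    ~~ side T e v -> side T e w -> e \in S /\ connect (step_reversing T S) (src e) w.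
  move=> eT vw sv sw; have [| x [y [sx sy /existsP[f /andP[fT step]] yw]]] :=
    connect_crossing (P := fun z => ~~ side T e z) vw sv; first by rewrite negbK.
  rewrite negbK in sy; have [fe | fe] := eqVneq f e; last first.
    by move: step sx sy; case: ifP => _ /andP[/eqP<- /eqP<-];
      rewrite side_edge // => /negPf ->.
  move: step sx sy yw; rewrite fe; case: ifP => eS /andP[/eqP<- /eqP<-] //.
  by rewrite side_src.
apply/forallP/eqP => [reach | SE v].
  apply/setP => e; rewrite inE; have [eT | eT] := boolP (e \in T); last first.
    by apply: contraNF eT; apply: (subsetP sub).
  have [sr | sr] := boolP (side T e r).
    by have [] := enter e _ _ eT (reach (tgt e)) (side_tgt acyc eT) sr.
  by apply/negbTE; have [] := leave e _ _ eT (reach (src e)) (side_src _ _) sr.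
(* The undirected path from [v] to [r] has an edge from some [x] that cannot reach [r] to some [y]
   that can. Either it is directed from [x] to [y], or the directed path from [y] to [r] must cross
   it and pass through [x]. *)
apply: contraT => vr.
have vr_conn : connect (adj_in T) v r.
  by have /forallP/(_ v)/forallP := conn.
have [|x [y [xr yr /existsP[e /andP[eT adj]] _]]] :=
  connect_crossing (P := fun z => ~~ connect (step_reversing T S) z r) vr_conn vr.
  by rewrite negbK connect0.
rewrite negbK in yr.
suff : connect (step_reversing T S) x r by rewrite (negPf xr).
have stepP u w : (if e \in S then (tgt e == u) && (src e == w)
    else (src e == u) && (tgt e == w)) -> connect (step_reversing T S) u w.
  by move=> st; apply/connect1/existsP; exists e; rewrite eT.
move: (stepP x y); have := SE => /setP /(_ e); rewrite inE eT /= => ->.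
case: ifP => sr stepxy; case/orP: adj => /andP[/eqP ex /eqP ey]; subst x y.
- by have [] := enter e _ _ eT yr (side_tgt acyc eT) sr.
- by apply: connect_trans yr; apply: stepxy; rewrite !eqxx.
- by apply: connect_trans yr; apply: stepxy; rewrite !eqxx.
- by have [] := leave e _ _ eT yr (side_src _ _) (negbT sr).
Qed.

Lemma k_spanning_treeE r k T :
  k_spanning_tree r k T = spanning_tree T && (#|away r T| == k).
Proof.
rewrite /k_spanning_tree; case tree: (spanning_tree T) => //=.
have subT : away r T \subset T by apply/subsetP => e; rewrite inE => /andP[].
apply/existsP/eqP => [[S /and3P[sub /eqP cS]] | ck].
  by rewrite reversal_away // => /eqP <-.
by exists (away r T); rewrite subT ck eqxx reversal_away //=.
Qed.

Lemma tree_polyE r :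
  tree_poly r = \sum_(T : {set dedge D} | spanning_tree T) 'X^#|away r T|.
Proof.
have numE k : (num_k_trees r k)%:R
    = \sum_(T : {set dedge D} | spanning_tree T) (#|away r T| == k)%:R :> int.
  rewrite /num_k_trees -sum1dep_card natr_sum [LHS]big_mkcond [RHS]big_mkcond /=.
  by apply: eq_bigr => T _; rewrite k_spanning_treeE; case: spanning_tree; case: eqP.
rewrite /tree_poly; under eq_bigr => k _ do rewrite numE scaler_suml.
rewrite exchange_big; apply: eq_bigr => T _ /=.
have lt : (#|away r T| < #|dedge D|.+1)%N by rewrite ltnS max_card.
rewrite (bigD1 (Ordinal lt)) //= eqxx scale1r big1 ?addr0 // => k kT.
case: eqP => [e | _]; last by rewrite scale0r.
by case/eqP: kT; apply/val_inj; rewrite /= e.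
Qed.

End Trees.

(** * Matrices whose kernel is the space of coboundaries *)

Section CircuitLine.
Variables (R : realType) (d N : nat) (A : 'M[R]_(d, N)).

Lemma circuit_neq0 l : circuit_vec A l -> l != 0.
Proof.
case=> /minsetP[nfr _] _; apply: contraNneq nfr => ->.
apply/free_colsP => l' _ /suppP sub; apply/colP => i; rewrite mxE sub //.
by rewrite inE mxE eqxx.
Qed.

(** Subtracting the multiple of [l] that cancels one coordinate leaves a kernel vector of strictly
    smaller support, zero by minimality. *)
Lemma circuit_line l l' : circuit_vec A l -> A *m l' = 0 ->
  supp l' \subset supp l -> exists a, l' = a *: l.
Proof.
move=> cl Al' sub; have [/minsetP[_ minl] Al] := cl.
have [i li] := suppN0 (circuit_neq0 cl).
exists (l' i 0 / l i 0); apply/eqP; rewrite -subr_eq0.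
set l'' := l' - _; have Al'' : A *m l'' = 0.
  by rewrite mulmxBr -scalemxAr Al Al' scaler0 subr0.
have l''i : l'' i 0 = 0 by rewrite !mxE divfK ?subrr.
have sub'' : supp l'' \subset supp l.
  apply/suppP => k kl; rewrite !mxE (suppP _ _ sub) // sub0r.
  by move: kl; rewrite inE negbK => /eqP ->; rewrite mulr0 oppr0.
apply: contraT => l''0.
have /minl /(_ sub'') suppE : ~~ free (cols A (supp l'')).
  by apply: contraNN l''0 => /free_colsP/(_ _ Al'' (subxx _)) ->.
have : i \in supp l'' by rewrite suppE inE.
by rewrite inE l''i eqxx.
Qed.

End CircuitLine.

Section DualRepresentation.
Variables (R : realType) (D : digraph) (d : nat).
Let V := dvertex D.
Let N := #|dedge D|.
Variable A : 'M[R]_(d, N).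
Hypothesis kerA : forall l : 'cV[R]_N,
  A *m l = 0 <-> exists phi : V -> R, l = delta phi.
Hypothesis conn : spanning_connected [set: dedge D].
Hypothesis dimA : (d + #|V|.-1 = N)%N.
Implicit Types (T S X : {set dedge D}) (u v r : V) (e f : dedge D).
Implicit Types (phi : V -> R) (l : 'cV[R]_N) (k : 'I_N).

Definition edge_indices X : {set 'I_N} := [set k | enum_val k \in X].

Lemma mem_edge_indices X e : (enum_rank e \in edge_indices X) = (e \in X).
Proof. by rewrite inE enum_rankK. Qed.

Lemma card_edge_indices X : #|edge_indices X| = #|X|.
Proof.
rewrite -(card_imset _ (@enum_rank_inj (dedge D))); apply: eq_card => k.
rewrite inE; apply/idP/imsetP => [kX | [e eX ->]]; last by rewrite enum_rankK.
by exists (enum_val k); rewrite ?enum_valK.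
Qed.

Lemma edge_indicesS X Y : (edge_indices X \subset edge_indices Y) = (X \subset Y).
Proof.
apply/subsetP/subsetP => sub k; last by rewrite !inE => /sub.
by rewrite -!mem_edge_indices => /sub.
Qed.

Lemma edge_indices_inj : injective edge_indices.
Proof.
by move=> X Y XY; apply/eqP; rewrite eqEsubset -!edge_indicesS XY subxx.
Qed.

Lemma edge_indices_imset (C : {set 'I_N}) :
  edge_indices [set enum_val k | k in C] = C.
Proof. by apply/setP => k; rewrite inE mem_imset //; apply: enum_val_inj. Qed.

Lemma supp_delta phi T :
  (supp (delta phi) \subset edge_indices (~: T)) <-> const_along T phi.
Proof.
split=> [/suppP sub e eT | phiT]; last first.
  by apply/suppP => k; rewrite !inE negbK => kT; rewrite mxE phiT ?subrr.
have := sub (enum_rank e); rewrite !inE enum_rankK eT => /(_ isT).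
by rewrite mxE enum_rankK => /eqP; rewrite subr_eq0 => /eqP.
Qed.

Lemma delta_ker phi : A *m delta phi = 0.
Proof. by apply/kerA; exists phi. Qed.

(** Kernel vectors supported off [T] are coboundaries of potentials constant along [T]; they all
    vanish exactly when [T] is connected. The cardinalities match by [dimA]. *)
Lemma base_spanning_tree r T :
  is_base A (edge_indices (~: T)) = spanning_tree T.
Proof.
rewrite is_baseE (spanning_treeE R r) andbC; congr (_ && _).
  apply/free_colsP/idP => [ker | /(spanning_connectedP R) connT l].
    apply/(spanning_connectedP R) => phi phiT.
    apply: ((spanning_connectedP R _).1 conn phi).
    by apply/delta_eq0/ker; [apply: delta_ker | apply/supp_delta].
  move=> /kerA[phi ->] /supp_delta phiT; apply/delta_eq0 => e _.
  exact: connT phiT _ _.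
rewrite card_edge_indices -(eqn_add2r #|T|) [X in X == _]addnC cardsC -/N -dimA.
by rewrite eqn_add2l eq_sym.
Qed.

Definition cut_vec (S : {set V}) : 'cV[R]_N := delta (fun v => (v \in S)%:R).

Lemma cut_vecE (S : {set V}) k : cut_vec S k 0
  = (enum_val k \in edges_out S)%:R - (enum_val k \in edges_out (~: S))%:R.
Proof.
rewrite mxE !inE negbK.
by case: (src _ \in S); case: (tgt _ \in S); rewrite /= ?subrr ?sub0r ?subr0.
Qed.

Lemma supp_cut_vec (S : {set V}) : supp (cut_vec S) = edge_indices (edge_cut S).
Proof.
apply/setP => k; rewrite inE cut_vecE !inE negbK.
by case: (src _ \in S); case: (tgt _ \in S);
  rewrite /= ?subrr ?sub0r ?subr0 ?oppr_eq0 ?eqxx ?oner_eq0.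
Qed.

Lemma pos_cut_vec (S : {set V}) : pos_part (cut_vec S) = edge_indices (edges_out S).
Proof.
apply/setP => k; rewrite inE cut_vecE !inE negbK.
by case: (src _ \in S); case: (tgt _ \in S);
  rewrite /= ?subrr ?sub0r ?subr0 ?oppr_gt0 ?ltxx ?ltr01 ?ltr10.
Qed.

Lemma neg_cut_vec (S : {set V}) :
  neg_part (cut_vec S) = edge_indices (edges_out (~: S)).
Proof.
apply/setP => k; rewrite inE cut_vecE !inE negbK.
by case: (src _ \in S); case: (tgt _ \in S);
  rewrite /= ?subrr ?sub0r ?subr0 ?oppr_lt0 ?ltxx ?ltr01 ?ltr10.
Qed.

Lemma edge_cutC (S : {set V}) : edge_cut (~: S) = edge_cut S.
Proof. by rewrite /edge_cut setCK setUC. Qed.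

Lemma cut_vec_neq0 (S : {set V}) : (cut_vec S != 0) = (edge_cut S != set0).
Proof.
apply/idP/idP => [/suppN0[k] | /set0Pn[e eS]].
  move=> ck; apply/set0Pn; exists (enum_val k).
  by have : k \in supp (cut_vec S) by [rewrite inE]; rewrite supp_cut_vec inE.
apply: contraTneq eS => c0; rewrite -mem_edge_indices -supp_cut_vec c0.
by rewrite inE mxE eqxx.
Qed.

(* A superlevel set of the potential has its cut in the support. *)
Lemma cut_in_supp l : A *m l = 0 -> l != 0 ->
  exists2 S, edge_cut S != set0 & supp (cut_vec S) \subset supp l.
Proof.
move=> /kerA[phi ->] /suppN0[k]; rewrite mxE subr_eq0 => neq.
pose m := Num.min (phi (src (enum_val k))) (phi (tgt (enum_val k))).
exists [set v | m < phi v].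
  apply/set0Pn; exists (enum_val k); rewrite !inE negbK -!leNgt /m.
  case: (ltrgtP (phi (src (enum_val k))) (phi (tgt (enum_val k)))) neq => // lt _.
    by rewrite ltxx lt lexx !andbT orbT.
  by rewrite ltxx lt lexx.
rewrite supp_cut_vec; apply/subsetP => k'; rewrite !inE negbK mxE subr_eq0.
by apply: contraTneq => ->; case: (m < _).
Qed.

Lemma dependentP (C : {set 'I_N}) : ~~ free (cols A C) <->
  exists2 S, edge_cut S != set0 & edge_indices (edge_cut S) \subset C.
Proof.
split=> [/free_colsP/existsNP[l /not_implyP[Al /not_implyP[sub /eqP l0]]]
    | [S S0 sub]].
  have [S S0 subS] := cut_in_supp Al l0; exists S => //.
  by rewrite -supp_cut_vec; apply: subset_trans sub.
apply/free_colsP => /(_ (cut_vec S) (delta_ker _)).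
by rewrite supp_cut_vec => /(_ sub)/eqP; apply/negP; rewrite cut_vec_neq0.
Qed.

Lemma circuit_bond X : is_circuit A (edge_indices X) = bond X.
Proof.
apply/minsetP/minsetP => [[/dependentP[S S0 sub] minX] | ].
  have XE : edge_indices (edge_cut S) = edge_indices X.
    by apply: minX => //; apply/dependentP; exists S.
  move/edge_indices_inj: XE => XE; split.
    by rewrite -XE S0; apply/existsP; exists S.
  move=> Y /andP[Y0 /existsP[S' /eqP YE]] YX; apply/edge_indices_inj/minX.
    by apply/dependentP; exists S'; rewrite -YE.
  by rewrite edge_indicesS.
case=> /andP[X0 /existsP[S /eqP XE]] minX; split.
  by apply/dependentP; exists S; rewrite -XE.
move=> C /dependentP[S' S'0 sub'] sub.
have S'E : edge_cut S' = X.
  apply: minX; first by rewrite S'0; apply/existsP; exists S'.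
  by rewrite -edge_indicesS; apply: subset_trans sub.
by apply/eqP; rewrite eqEsubset sub -S'E.
Qed.

Lemma circuit_cut_vec l : circuit_vec A l ->
  exists2 S, bond (edge_cut S) & exists2 a, 0 < a & l = a *: cut_vec S.
Proof.
move=> cl; have [circ Al] := cl.
have [S S0 sub] := cut_in_supp Al (circuit_neq0 cl).
have [a cE] : exists a, cut_vec S = a *: l := circuit_line cl (delta_ker _) sub.
have a0 : a != 0.
  by apply: contraNneq S0 => a0;
    rewrite -[_ == _]negbK -cut_vec_neq0 cE a0 scale0r eqxx.
have lE : l = a^-1 *: cut_vec S by rewrite cE scalerK.
have bS : bond (edge_cut S).
  by rewrite -circuit_bond -supp_cut_vec cE suppZ.
case: (ltrgt0P a) a0 => // a0 _.
  by exists S => //; exists a^-1; rewrite ?invr_gt0.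
(* Passing to the complement negates the cut vector, which makes the factor positive. *)
exists (~: S); first by rewrite edge_cutC.
exists (- a^-1); first by rewrite oppr_gt0 invr_lt0.
rewrite lE scaleNr -scalerN; congr (_ *: _); apply/colP => k.
by rewrite !mxE !inE; do 2!case: (_ \in S);
  rewrite /= ?subrr ?sub0r ?subr0 ?oppr0 ?opprK.
Qed.

Lemma bond_circuit_vec (S : {set V}) : bond (edge_cut S) -> circuit_vec A (cut_vec S).
Proof. by move=> bS; split; rewrite ?delta_ker // supp_cut_vec circuit_bond. Qed.

Lemma cographic_dual : cographic (om_of_matrix A).
Proof.
exists D, enum_val; first exact: enum_val_bij.
move=> X Y; split=> [[l [cl -> ->]] | [S [bS XE YE]]]; last first.
  exists (cut_vec S); rewrite pos_cut_vec neg_cut_vec -XE -YE !edge_indices_imset.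
  by split=> //; apply: bond_circuit_vec.
have [S bS [a a0 ->]] := circuit_cut_vec cl; exists S; split=> //.
  apply: edge_indices_inj; rewrite edge_indices_imset -pos_cut_vec.
  by apply/setP => k; rewrite !inE mxE pmulr_rgt0.
apply: edge_indices_inj; rewrite edge_indices_imset -neg_cut_vec.
by apply/setP => k; rewrite !inE mxE pmulr_rlt0.
Qed.

(** Adding signed unit vectors along a path from [r] to [v] gives a vector that pairs with each
    coboundary to [phi r - phi v]; these are summed over [v]. *)
Lemma ex_root_vec r :
  exists rho, forall phi, dot (delta phi) rho = \sum_v (phi r - phi v).
Proof.
have path v : exists rho, forall phi, dot (delta phi) rho = phi r - phi v.
  have /forallP/(_ r)/forallP/(_ v) rv := conn.
  apply: (connect_invariant (P := fun v => exists rho, forall phi,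
    dot (delta phi) rho = phi r - phi v) _ rv)
    => [u w /existsP[e /andP[_ uw]] [rho uP] | ]; last first.
    by exists 0 => phi; rewrite subrr; apply: big1 => k _; rewrite [X in _ * X]mxE mulr0.
  have dot_edge phi :
      dot (delta phi) (delta_mx (enum_rank e) 0) = phi (src e) - phi (tgt e).
    rewrite /dot (bigD1 (enum_rank e)) //= big1 ?addr0 => [|k ke].
      by rewrite !mxE enum_rankK !eqxx mulr1.
    by rewrite !mxE (negPf ke) mulr0.
  case/orP: uw => /andP[/eqP <- /eqP <-] in uP *.
    by exists (rho + delta_mx (enum_rank e) 0) => phi;
      rewrite dotDr uP dot_edge addrA subrK.
  exists (rho - delta_mx (enum_rank e) 0) => phi; rewrite dotBr uP dot_edge.
  by rewrite opprB addrA subrK.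
have [rho rhoP] := choice path.
exists (\sum_v rho v) => phi; under [RHS]eq_bigr => v _ do rewrite -rhoP.
rewrite /dot exchange_big; apply: eq_bigr => k _.
by rewrite summxE mulr_sumr.
Qed.

(** The pairing with the cut vector of [S] is the size of the complement of [S] if [r] lies in [S],
    and minus the size of [S] otherwise. *)
Lemma root_vec_generic r rho :
  (forall phi, dot (delta phi) rho = \sum_v (phi r - phi v)) -> generic A rho.
Proof.
move=> rhoP l cl; have [S _ [a a0 lE]] := circuit_cut_vec cl.
have : cut_vec S != 0.
  by apply: contraNneq (circuit_neq0 cl) => c0; rewrite lE c0 scaler0.
rewrite cut_vec_neq0 lE dotZl mulf_eq0 gt_eqF //= rhoP => /set0Pn[e eS].
have [v [v' [vS v'S]]] : exists v v', v \in S /\ v' \notin S.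
  move: eS; rewrite !inE negbK => /orP[] /andP[? ?];
    by [exists (src e), (tgt e) | exists (tgt e), (src e)].
have [rS | rS] := boolP (r \in S).
  rewrite psumr_neq0 => [|w _]; last by case: (w \in S); rewrite ?subrr ?subr0 ?ler01.
  apply/hasP; exists v'; rewrite ?mem_index_enum //= (negPf v'S) subr0.
  exact: ltr01.
rewrite -oppr_eq0 -sumrN psumr_neq0 => [|w _]; last by rewrite sub0r opprK ler0n.
apply/hasP; exists v; rewrite ?mem_index_enum //= vS sub0r opprK.
exact: ltr01.
Qed.

Lemma side_fundamental T e : spanning_tree T -> e \in T ->
  fundamental A (edge_indices (~: T)) (enum_rank e)
    (delta (fun v => (side T e v)%:R)).
Proof.
case/andP=> _ acyc eT; split; first exact: delta_ker.
  have -> : enum_rank e |: edge_indices (~: T) = edge_indices (~: (T :\ e)).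
    apply/setP => k; rewrite !inE negb_and negbK; congr (_ || _).
    by apply/eqP/eqP => [-> | <-]; rewrite ?enum_rankK ?enum_valK.
  apply/supp_delta => f; rewrite !inE => /andP[fe fT].
  by rewrite side_edge.
by rewrite mxE enum_rankK side_src (negPf (side_tgt acyc eT)) subr0.
Qed.

(** The pairing with the fundamental vector of [e] is positive if [r] is on the source side, [tgt e]
    being counted on the other one, and is at most 0 otherwise. *)
Lemma ext_away r rho T :
  (forall phi, dot (delta phi) rho = \sum_v (phi r - phi v)) ->
  spanning_tree T -> ext A rho (edge_indices (~: T)) = #|away r T|.
Proof.
move=> rhoP tree; rewrite -card_edge_indices; apply: eq_card => k.
rewrite -(enum_valK k) inE mem_edge_indices; set e := enum_val k; rewrite [RHS]inE.
have fresh : (enum_rank e \notin edge_indices (~: T)) = (e \in T).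
  by rewrite mem_edge_indices inE negbK.
have baseT : is_base A (edge_indices (~: T)) by rewrite (base_spanning_tree r).
have [eT | eT] := boolP (e \in T); last first.
  by apply/asboolP => -[]; rewrite fresh (negPf eT).
have fund := side_fundamental tree eT.
transitivity (0 < dot (delta (fun v => (side T e v)%:R)) rho).
  apply/asboolP/idP => [/(ext_semi_activeE rho baseT fund)[] // | pos].
  by apply/(ext_semi_activeE rho baseT fund); rewrite fresh.
have /andP[_ acyc] := tree.
rewrite rhoP; have [sr | sr] := boolP (side T e r); last first.
  apply/negbTE; rewrite -leNgt; apply: sumr_le0 => v _.
  by rewrite sub0r oppr_le0.
rewrite (bigD1 (tgt e)) //= (negPf (side_tgt acyc eT)) subr0.
rewrite ltr_pwDl ?ltr01 //; apply: sumr_ge0 => v _.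
by case: side; rewrite ?subrr ?subr0 ?ler01.
Qed.

Lemma ext_poly_tree_poly r :
  (forall B, is_base A B -> `|det_cols A B| = 1) ->
  exists2 rho, generic A rho & map_poly intr (tree_poly r) = ext_poly A rho.
Proof.
move=> uni; have [rho rhoP] := ex_root_vec r.
exists rho; first exact: root_vec_generic rhoP.
rewrite tree_polyE rmorph_sum /ext_poly.
pose h T := edge_indices (~: T).
rewrite (reindex h) /=; last first.
  exists (fun B : {set 'I_N} => ~: [set enum_val k | k in B]) => [T | B] _.
    by apply: edge_indices_inj; rewrite -{2}[T]setCK; apply/setP => k;
      rewrite inE inE -mem_edge_indices edge_indices_imset mem_edge_indices !inE.
  by rewrite /h setCK edge_indices_imset.
apply: eq_big => [T | T tree]; first by rewrite (base_spanning_tree r).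
rewrite uni ?(base_spanning_tree r) // scale1r (ext_away rhoP tree).
by rewrite map_polyXn.
Qed.

End DualRepresentation.

(** * Reduced incidence matrices *)

(** Circuits depend only on the kernel, so deleting a redundant row preserves the oriented
    matroid. *)
Lemma eq_ker_circuit_vec (R : realType) (d d' N : nat)
    (A : 'M[R]_(d, N)) (A' : 'M[R]_(d', N)) :
  (forall l : 'cV_N, A *m l = 0 <-> A' *m l = 0) ->
  forall l, circuit_vec A l <-> circuit_vec A' l.
Proof.
move=> kerE l; have freeE C : free (cols A C) = free (cols A' C).
  by apply/free_colsP/free_colsP => ker l' /kerE; apply: ker.
rewrite /circuit_vec kerE /is_circuit.
by rewrite (@minset_eq _ _ (fun C => ~~ free (cols A' C))) // => C; rewrite freeE.
Qed.

(* Expand along a column with a single non-zero entry; if there is none and no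
   zero column, the rows add up to zero. *)
Lemma det_incidence (R : realType) (n : nat) (a b : 'I_n -> option 'I_n) :
  let M := \matrix_(i, k) ((Some i == a k)%:R - (Some i == b k)%:R : R) in
  \det M = 0 \/ `|\det M| = 1.
Proof.
elim: n a b => [|n IHn] a b M; first by right; rewrite det_mx00 normr1.
(* [None] stands for an end at a deleted vertex. Minors keep this form: ends in the removed row [i]
   become [None]. *)
have minor i k : \det (row' i (col' k M)) = 0 \/ `|\det (row' i (col' k M))| = 1.
  have -> : row' i (col' k M) = \matrix_(i', k')
      ((Some i' == obind (unlift i) (a (lift k k')))%:R
       - (Some i' == obind (unlift i) (b (lift k k')))%:R : R).
    apply/matrixP => i' k'; rewrite !mxE.
    have unliftE (o : option 'I_n.+1) :
        (Some (lift i i') == o) = (Some i' == obind (unlift i) o).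
      case: o => //= x; case: unliftP => [y -> | ->].
        by rewrite !(inj_eq (@Some_inj _)) (inj_eq lift_inj).
      by rewrite (inj_eq (@Some_inj _)) eq_sym (negPf (neq_lift _ _)).
    by rewrite !unliftE.
  exact: IHn.
have single k i s : (forall i', M i' k = (-1) ^+ s * (i' == i)%:R) ->
    \det M = 0 \/ `|\det M| = 1.
  move=> Mk; rewrite (expand_det_col M k) (bigD1 i) //= big1 ?addr0 => [|i' i'i].
    rewrite Mk eqxx mulr1 /cofactor mulrA -exprD normrM normrX normrN1 expr1n mul1r.
    by case: (minor i k) => ->; [left; rewrite mulr0 | right].
  by rewrite Mk (negPf i'i) mulr0 mul0r.
have [/existsP[k /eqP ak] | /existsPn aN] := boolP [exists k, a k == None].
  case bk: (b k) => [i|].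
    by apply: (single k i true) => i'; rewrite mxE ak bk sub0r expr1 mulN1r.
  left; rewrite (expand_det_col M k) big1 // => i _.
  by rewrite mxE ak bk subrr mul0r.
have [/existsP[k /eqP bk] | /existsPn bN] := boolP [exists k, b k == None].
  case ak: (a k) (aN k) => [i|] // _.
  by apply: (single k i false) => i'; rewrite mxE ak bk subr0 expr0 mul1r.
left; apply/eqP/det0P; exists (const_mx 1).
  by apply/eqP => /rowP/(_ ord0)/eqP; rewrite !mxE oner_eq0.
apply/rowP => k; rewrite !mxE.
under eq_bigr => i _ do rewrite !mxE mul1r.
case: (a k) (aN k) => // x _; case: (b k) (bN k) => // y _.
rewrite sumrB (bigD1 x) //= eqxx big1 => [|i ix]; last first.
  by rewrite (inj_eq (@Some_inj _)) (negPf ix).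
rewrite (bigD1 y) //= eqxx big1 => [|i iy]; last first.
  by rewrite (inj_eq (@Some_inj _)) (negPf iy).
by rewrite addr0 subrr.
Qed.

Section ReducedIncidence.
Variables (R : realType) (D : digraph) (v0 : dvertex D).
Let V := dvertex D.
Let I := incidence_mx D R.

Definition reduced_incidence : 'M[R]_(#|V|.-1, #|dedge D|) :=
  row' (enum_rank v0) I.

(** The rows of the incidence matrix add up to zero, so the deleted equation follows from the
    others. *)
Lemma reduced_ker (l : 'cV[R]_#|dedge D|) : reduced_incidence *m l = 0 <-> I *m l = 0.
Proof.
have rowE i : (reduced_incidence *m l) i 0 = (I *m l) (lift (enum_rank v0) i) 0.
  by rewrite !mxE; apply: eq_bigr => k _; rewrite [row' _ _ _ _]mxE.
split=> [Al | Il]; last by apply/colP => i; rewrite rowE Il !mxE.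
have sum0 : const_mx 1 *m (I *m l) = 0 :> 'M_1.
  rewrite mulmxA mulmx_incidence [delta _](_ : _ = 0) ?trmx0 ?mul0mx //.
  by apply/colP => k; rewrite !mxE subrr.
have lift0 i : (I *m l) (lift (enum_rank v0) i) 0 = 0 by rewrite -rowE Al mxE.
apply/colP => i; rewrite [RHS]mxE.
case: (unliftP (enum_rank v0) i) => [j -> // | ->].
have := congr1 (fun M : 'M_1 => M 0 0) sum0; rewrite mxE [RHS]mxE => {1}<-.
rewrite (bigD1 (enum_rank v0)) //= [const_mx _ _ _]mxE mul1r big1 ?addr0 // => j.
by case: (unliftP (enum_rank v0) j) => [j' -> _ | -> /eqP //]; rewrite lift0 mulr0.
Qed.

Lemma mulmx_reduced (x : 'rV[R]_#|V|) : x 0 (enum_rank v0) = 0 ->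
  col' (enum_rank v0) x *m reduced_incidence = x *m I.
Proof.
move=> x0; apply/rowP => k; rewrite !mxE [RHS](bigD1_ord (enum_rank v0)) //=.
by rewrite x0 mul0r add0r; apply: eq_bigr => i _; rewrite !mxE.
Qed.

Lemma rank_reduced : spanning_connected [set: dedge D] ->
  \rank reduced_incidence = #|V|.-1.
Proof.
move=> /(spanning_connectedP R) conn; apply/eqP/inj_row_free => y yA.
pose x : 'rV[R]_#|V| := \row_i oapp (y 0) 0 (unlift (enum_rank v0) i).
have x0 : x 0 (enum_rank v0) = 0 by rewrite mxE unlift_none.
have xy : col' (enum_rank v0) x = y by apply/rowP => i; rewrite !mxE liftK.
have : (x *m I)^T = 0 by rewrite -mulmx_reduced // xy yA trmx0.
rewrite mulmx_incidence trmxK => /delta_eq0 /conn xc.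
rewrite -xy; apply/rowP => i; rewrite [LHS]mxE [RHS]mxE -x0.
by have := xc (enum_val (lift (enum_rank v0) i)) v0; rewrite enum_valK.
Qed.

Lemma reduced_unimodular B : is_base reduced_incidence B ->
  `|det_cols reduced_incidence B| = 1.
Proof.
move=> bB; have cB := base_card bB; rewrite (det_colsE _ cB).
set M := colsub _ _; pose a v := unlift (enum_rank v0) (enum_rank v).
have ME : M = \matrix_(i, k)
    ((Some i == a (src (enum_val (enum_base cB k))))%:R
     - (Some i == a (tgt (enum_val (enum_base cB k))))%:R).
  have unliftE i v : (enum_val (lift (enum_rank v0) i) == v)
      = (Some i == a v).
    rewrite -(inj_eq enum_rank_inj) enum_valK /a.
    case: unliftP => [j -> | ->];
      first by rewrite (inj_eq lift_inj) (inj_eq (@Some_inj _)).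
    by rewrite eq_sym (negPf (neq_lift _ _)).
  by apply/matrixP => i k; rewrite !mxE !unliftE.
have [] := det_incidence R
  (fun k => a (src (enum_val (enum_base cB k))))
  (fun k => a (tgt (enum_val (enum_base cB k)))); rewrite -ME //.
(* In the singular case, a null vector placed on the columns of [B] is a nonzero kernel vector
   supported in a base. *)
rewrite -det_tr => /eqP/det0P[y y0 yM].
pose l : 'cV[R]_#|dedge D| := \sum_k y 0 k *: delta_mx (enum_base cB k) 0.
have lE k : l (enum_base cB k) 0 = y 0 k.
  rewrite summxE (bigD1 k) //= big1 ?addr0 => [|k' k'k].
    by rewrite !mxE !eqxx mulr1.
  by rewrite !mxE (inj_eq (@enum_base_inj _ _ _ cB)) eq_sym (negPf k'k) mulr0.
case/negP: y0; apply/eqP/rowP => k; rewrite mxE -lE.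
rewrite (base_ker bB (l := l)) ?mxE //.
  have : (y *m M^T)^T = 0 by rewrite yM trmx0.
  rewrite trmx_mul trmxK => <-; rewrite mulmx_sumr; apply/colP => i.
  rewrite summxE mxE; apply: eq_bigr => k' _.
  by rewrite -scalemxAr -colE !mxE mulrC.
apply/suppP => i iB; rewrite summxE big1 // => k' _; rewrite !mxE.
case: eqP => [ik | _]; last by rewrite mulr0.
by rewrite ik enum_valP in iB.
Qed.

Lemma graphic_reduced : graphic R (om_of_matrix reduced_incidence).
Proof.
exists D, id; first by exists id.
have cvE := eq_ker_circuit_vec reduced_ker.
by move=> X Y; rewrite !imset_id; split=> -[l [/cvE cl -> ->]]; exists l.
Qed.

End ReducedIncidence.

(** * Plane graphs *)

Section Plane.
Variables (R : realType) (G : plane_graph).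
Implicit Types (x y z : edge G * bool) (c : vertex G -> bool).

Lemma rev_dartK : involutive (@rev_dart (edge G)).
Proof. by case=> e b; rewrite /rev_dart /= negbK. Qed.

Lemma tail_rot x : tail (Defs.rot G x) = tail x.
Proof. by apply/esym/Defs.rotP/fconnect1. Qed.

Lemma left_face_rev x : left_face (rev_dart x) = left_face ((Defs.rot G)^-1%g x).
Proof.
apply/left_faceP/connect1; apply/eqP.
by rewrite rev_dartK.
Qed.

Lemma sum_darts (W : nmodType) (F : edge G * bool -> W) c :
  \sum_x F x = \sum_e (F (dart_from c e) + F (rev_dart (dart_from c e))).
Proof.
transitivity (\sum_e \sum_b F (e, b)).
  by rewrite pair_bigA; apply: eq_bigr => -[].
apply: eq_bigr => e _; rewrite big_bool /dart_from /rev_dart /=.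
by case: (c _) => //=; rewrite addrC.
Qed.

Definition primal_digraph c : digraph :=
  @Digraph (vertex G) (edge G) (fun e => tail (dart_from c e))
    (fun e => tail (rev_dart (dart_from c e))).

(* Around a vertex, the jumps of a function of the faces telescope. *)
Lemma primal_dual_orthogonal c :
  incidence_mx (dual_digraph c) R *m (incidence_mx (primal_digraph c) R)^T = 0.
Proof.
apply/row_matrixP => i; rewrite row_mul row0.
set f := row i _; have -> : f = delta_mx 0 i *m incidence_mx (dual_digraph c) R.
  by rewrite /f rowE.
rewrite mulmx_incidence -trmx_mul; set phi := fun v => _; clearbody phi.
apply/eqP; rewrite -trmx0 (inj_eq trmx_inj); apply/eqP/colP => w.
rewrite !mxE.
pose v := enum_val w : vertex G.
(* Each edge gives two darts; the jump across the reversed dart is the opposite one, as is the sign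
   of the head in the incidence matrix. *)
transitivity (\sum_(x : edge G * bool)
   (v == tail x)%:R * (phi (left_face x) - phi (left_face (rev_dart x)))).
  rewrite (sum_darts _ c) (reindex _ (onW_bij _ (@enum_rank_bij (edge G)))) /=.
  apply: eq_bigr => e _; rewrite !mxE !enum_rankK /= rev_dartK.
  by rewrite -/v; ring.
under eq_bigr => x _ do rewrite mulrBr left_face_rev.
rewrite sumrB [X in _ - X](reindex_inj (@perm_inj _ (Defs.rot G))) /=.
by under [X in _ - X]eq_bigr => x _ do rewrite permK tail_rot; rewrite subrr.
Qed.

Lemma primal_connected c : spanning_connected [set: dedge (primal_digraph c)].
Proof.
apply/forallP => u; apply/forallP => v.
have uv := plane_connected u v; apply: connect_sub uv => a b.
move=> /existsP[x /andP[/eqP <- /eqP <-]]; apply: connect1.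
apply/existsP; exists x.1; rewrite inE /= /dart_from /rev_dart.
by case: x => e [] /=; case: (c _); rewrite /= !eqxx ?orbT.
Qed.

(** A potential constant along dual edges gives a function on darts invariant under reversal, hence
    under [rot]; connectivity of [G] makes it constant. *)
Lemma dual_connected c : spanning_connected [set: dedge (dual_digraph c)].
Proof.
apply/(spanning_connectedP R) => phi phiT.
pose g x := phi (left_face x).
have g_rev x : g (rev_dart x) = g x.
  have := phiT x.1 (in_setT _); rewrite /= /dart_from /rev_dart /g.
  by case: x => e [] /=; case: (c _) => //=.
have g_tail x y : tail x = tail y -> g x = g y.
  move/Defs.rotP => xy; apply: (connect_invariant (P := fun z => g x = g z) _ xy erefl).
  move=> z z' /eqP <- ->; rewrite -[in LHS](permK (Defs.rot G) z) /g.
  by rewrite -left_face_rev -/(g _) g_rev.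
have g_const x y : g x = g y.
  have xy := plane_connected (tail x) (tail y).
  apply: (connect_invariant
    (P := fun v => forall z, tail z = v -> g x = g z) _ xy) => //.
    move=> a b /existsP[z /andP[/eqP za /eqP zb]] Pa w wb.
    by rewrite (Pa _ za) -g_rev; apply: g_tail; rewrite zb.
  by move=> z zx; apply: g_tail.
move=> f f'; have [e0 | eN0] := posnP #|edge G|.
  (* Without edges there are no darts, and Euler's formula leaves at most one face. *)
  suff : (#|face G| <= 1)%N by move/card_le1_eqP/(_ f f' isT isT) => ->.
  have v1 : (0 < #|vertex G|)%N := plane_nonempty G.
  by have := euler_formula G; rewrite e0 => eul; lia.
have [x <-] := left_face_onto eN0 f; have [y <-] := left_face_onto eN0 f'.
exact: g_const.
Qed.

Lemma primal_rank c : \rank (incidence_mx (primal_digraph c) R) = #|vertex G|.-1.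
Proof.
have /card_gt0P[v0 _] := plane_nonempty G.
exact: rank_incidence (v0 : dvertex (primal_digraph c)) (primal_connected c).
Qed.

Lemma euler_pred : (#|vertex G|.-1 + #|face G|.-1 = #|edge G|)%N /\ (0 < #|face G|)%N.
Proof.
have v0 : (0 < #|vertex G|)%N := plane_nonempty G.
have le : (#|vertex G|.-1 <= #|edge G|)%N.
  by rewrite -(primal_rank (fun=> true)); apply: rank_leq_col.
have := euler_formula G; move: v0 le.
by move: #|vertex G| #|face G| #|edge G| => a b e; lia.
Qed.

(** Orthogonality gives one inclusion; both spaces have dimension [#|face G|.-1] by Euler's
    formula. *)
Lemma primal_ker c (l : 'cV[R]_#|edge G|) :
  incidence_mx (primal_digraph c) R *m l = 0 <->
  exists phi, l = delta (D := dual_digraph c) phi.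
Proof.
have [eul /card_gt0P[r _]] := euler_pred.
have sub : (incidence_mx (dual_digraph c) R
    <= kermx (incidence_mx (primal_digraph c) R)^T)%MS.
  by apply/sub_kermxP/primal_dual_orthogonal.
have rankE : \rank (incidence_mx (dual_digraph c) R)
    = \rank (kermx (incidence_mx (primal_digraph c) R)^T).
  rewrite mxrank_ker mxrank_tr primal_rank.
  rewrite (rank_incidence R (r : dvertex (dual_digraph c)) (dual_connected c)) /=.
  by rewrite -eul addKn.
have := mxrank_leqif_eq sub; rewrite rankE => -[_ /esym]; rewrite eqxx => /eqmxP eqk.
have -> : incidence_mx (primal_digraph c) R *m l = 0
    <-> l^T *m (incidence_mx (primal_digraph c) R)^T = 0.
  rewrite -trmx_mul; split=> [-> | ]; first exact: trmx0.
  by move/(congr1 trmx); rewrite trmxK trmx0.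
split=> [/sub_kermxP | [phi ->]].
  rewrite -eqk => /submxP[x lE]; exists (fun f => x 0 (enum_rank f)).
  by apply: trmx_inj; rewrite lE mulmx_incidence.
by apply/sub_kermxP; rewrite -eqk (delta_row (D := dual_digraph c)) submxMl.
Qed.

Lemma tail_dart_from c e : proper_2coloring c ->
  c (tail (dart_from c e)) = true /\ c (tail (rev_dart (dart_from c e))) = false.
Proof.
move=> col; have := col (e, true); rewrite /dart_from /rev_dart /=.
by case ct: (c (tail (e, true))) => /=;
  case cf: (c (tail (e, false))) => //=; rewrite ct.
Qed.

Lemma flat_reduced c (v0 : dvertex (primal_digraph c)) : proper_2coloring c ->
  flat (reduced_incidence R v0).
Proof.
move=> col.
(* The colour indicator drops by 1 along every edge; subtracting its value at [v0] makes the deleted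
   coordinate zero. *)
pose x : 'rV[R]_#|vertex G| := \row_i ((c (enum_val i))%:R - (c v0)%:R).
have x0 : x 0 (enum_rank v0) = 0 by rewrite mxE enum_rankK subrr.
exists (col' (enum_rank v0) x) => k; rewrite mulmx_reduced // mulmx_incidence !mxE.
rewrite !enum_rankK /=; have [-> ->] := tail_dart_from (enum_val k : edge G) col.
by rewrite /=; ring.
Qed.

Lemma two_colorings c c' : proper_2coloring c -> proper_2coloring c' ->
  (forall v, c' v = c v) \/ (forall v, c' v = ~~ c v).
Proof.
move=> col col'; have /card_gt0P[v0 _] := plane_nonempty G.
have xorE v : c v (+) c' v = c v0 (+) c' v0.
  apply: (connect_invariant (P := fun v => c v (+) c' v = c v0 (+) c' v0) _
    (plane_connected v0 v)) => // a b /existsP[x /andP[/eqP <- /eqP <-]] <-.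
  by have := col x; have := col' x; do 4!case: (_ (tail _)).
have [eq0 | neq0] := eqVneq (c v0) (c' v0); [left | right] => v; have := xorE v.
  by rewrite eq0 addbb; do 2!case: (_ v).
by move: neq0; case: (c v0); case: (c' v0) => // _; do 2!case: (_ v).
Qed.

(** Swapping the colours reverses every dual edge, which amounts to negating the potential. *)
Lemma delta_recolor c c' (l : 'cV[R]_#|edge G|) :
  proper_2coloring c -> proper_2coloring c' ->
  (exists phi, l = delta (D := dual_digraph c) phi) <->
  (exists phi, l = delta (D := dual_digraph c') phi).
Proof.
move=> col col'; have [cE | cE] := two_colorings col col'.
  by rewrite (funext cE).
have dE phi : delta (D := dual_digraph c') phi
    = delta (D := dual_digraph c) (fun f => - phi f).
  apply/colP => k; rewrite !mxE /= /dart_from cE /rev_dart /= negbK.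
  by rewrite opprK addrC.
split=> -[phi ->]; exists (fun f => - phi f); last exact: dE.
by apply/colP => k; rewrite dE !mxE !opprK.
Qed.

End Plane.

(** * Equality up to units, and the conclusion *)

Lemma sim_compN (R : comNzRingType) (p q : {poly R}) :
  sim (p \Po - 'X) q -> sim p (q \Po - 'X).
Proof.
have XN k : 'X^k \Po (- 'X) = (-1) ^+ k * 'X^k :> {poly R}.
  by rewrite rmorphXn /= comp_polyX; apply: exprNn.
have XNN : (- 'X) \Po (- 'X) = 'X :> {poly R} by rewrite rmorphN /= comp_polyX opprK.
case=> s [m [n /(congr1 (comp_poly (- 'X)))]].
rewrite !rmorphM /= rmorph_sign !XN -comp_polyA XNN comp_polyXr => eqs.
(* Substituting [- 'X] into the monomials contributes the signs of exponents [m] and [n], collected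
   modulo 2. *)
exists (odd (m + s + n)), m, n; rewrite signr_odd !exprD.
transitivity ((-1) ^+ m * ((-1) ^+ m * 'X^m * p)).
  by rewrite !mulrA -expr2 sqrr_sign mul1r.
by rewrite eqs !mulrA.
Qed.

Lemma sim_map (R S : comNzRingType) (h : {rmorphism R -> S}) (p q : {poly R}) :
  sim p q -> sim (map_poly h p) (map_poly h q).
Proof.
case=> s [m [n /(congr1 (map_poly h))]]; rewrite !rmorphM /= rmorph_sign.
by rewrite !map_polyXn => eqs; exists s, m, n.
Qed.

Theorem theorem1 (R : realType) (G : plane_graph) (hG : bipartite G) :
  exists (d N : nat) (A : 'M[R]_(d, N)),
    \rank A = d /\ flat A /\
    graphic R (om_of_matrix A) /\ cographic (om_of_matrix A) /\
    exists fA : {poly R}, is_f A fA /\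
      forall Delta : {poly int}, is_alexander G Delta ->
        sim (map_poly intr Delta) (fA \Po - 'X).
Proof.
have [c col] := hG.
have /card_gt0P[v0 _] := plane_nonempty G.
pose v : dvertex (primal_digraph c) := v0.
have [eul /card_gt0P[r _]] := euler_pred R G.
pose A := reduced_incidence R v.
have uni := @reduced_unimodular R _ v.
have flA : flat A by apply: flat_reduced.
(* Proved for every proper colouring, since the one provided by [is_alexander] may differ from
   [c]. *)
have kerA c' : proper_2coloring c' -> forall l : 'cV[R]_#|edge G|,
    A *m l = 0 <-> exists phi, l = delta (D := dual_digraph c') phi.
  by move=> col' l; rewrite reduced_ker primal_ker; apply: delta_recolor.
have treeA (c' : vertex G -> bool) (r' : dvertex (dual_digraph c')) :
    proper_2coloring c' -> exists2 rho, generic A rho & map_poly intr (tree_poly r') = ext_poly A rho.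
  move=> col'.
  exact: (@ext_poly_tree_poly R (dual_digraph c') _ A (kerA _ col')
    (dual_connected R c') eul r' uni).
exists #|vertex G|.-1, #|edge G|, A; split.
  exact: rank_reduced (primal_connected c).
split=> //; split; first exact: (graphic_reduced R v).
split; first exact: (@cographic_dual R (dual_digraph c) _ A (kerA _ col)).
have [rho gen _] := treeA c r col.
exists (ext_poly A rho); split.
  by split=> [|rho' gen']; [exists rho | apply: ext_poly_indep].
move=> Delta [c' [col' [r' simD]]]; have [rho' gen' treeE] := treeA c' r' col'.
(* Independence of the generic vector also absorbs the choice of colouring and root made in
   [is_alexander]. *)
rewrite (ext_poly_indep flA gen gen') -treeE.
have /sim_compN/(@sim_map _ R intr) := simD.
by rewrite map_comp_poly rmorphN /= map_polyX.
Qed.
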